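(* Let $(M,g)$ be a Riemannian manifold of dimension $n\ge2$ and let $G$ be a natural metric on $TM$ characterized by the functions $\alpha,\beta$. Let $K$ and $\bar K$ denote the sectional curvatures of $(M,g)$ and $(TM,G)$, respectively. Then: (i) $(TM,G)$ is never a manifold with negative sectional curvature. (ii) If $\bar K$ is constant, then $(TM,G)$ and $(M,g)$ are flat. (iii) If $\bar K$ is bounded and $\lim_{t\to+\infty}t\alpha(t)=+\infty$, then $(M,g)$ is flat. (iv) If $c\le\bar K\le C$ (possibly $c=-\infty$ and $C=+\infty$), then $c\le K\le C$.
   Context: All objects are $C^\infty$. $\pi:TM\to M$ is the tangent bundle. The connection map $\kappa:TTM\to TM$ of the Levi-Civita connection $\nabla$ of $g$ sends the velocity at $0$ of a curve $Y(s)$ in $TM$ to its covariant derivative $\frac{\nabla Y}{ds}(0)$. For $q\in M$, $u=(u_1,\dots,u_n)$ an orthonormal basis of $M_q$, $\xi\in\mathbb{R}^n$ and $v=\sum_i\xi^iu_i$, let $e_i(q,u,\xi),e_{n+i}(q,u,\xi)\in(TM)_v$ ($1\le i\le n$) be the vectors with $\pi_*(e_i)=u_i$, $\kappa(e_i)=0$, $\pi_*(e_{n+i})=0$, $\kappa(e_{n+i})=u_i$. A natural metric on $TM$ is a Riemannian metric $G$ such that $\pi:(TM,G)\to(M,g)$ is a Riemannian submersion, the horizontal spaces $\ker\kappa_v$ and vertical spaces $\ker\pi_{*v}$ are $G$-orthogonal, and the matrix of $G$ in the basis $e_1(q,u,\xi),\dots,e_{2n}(q,u,\xi)$ depends only on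 $\xi$. Equivalently, there are differentiable functions $\alpha,\beta:[0,+\infty)\to\mathbb{R}$ with $\alpha(t)>0$ and $\alpha(t)+t\beta(t)>0$ for all $t\ge0$ (the functions characterizing $G$) such that at $(q,u,\xi)$: $G(e_i,e_j)=\delta_{ij}$, $G(e_i,e_{n+j})=0$, $G(e_{n+i},e_{n+j})=\alpha(|\xi|^2)\delta_{ij}+\beta(|\xi|^2)\xi^i\xi^j$ for $1\le i,j\le n$. Flat means that the curvature tensor vanishes identically. *)

(* Defs.v *)
From HB Require Import structures.
From mathcomp Require Import all_boot all_order all_algebra.
From mathcomp Require Import all_classical all_reals all_analysis.
From mathcomp Require Import ring.

Set Implicit Arguments.
Unset Strict Implicit.
Unset Printing Implicit Defensive.

Import Order.TTheory GRing.Theory Num.Theory.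
Import numFieldNormedType.Exports.

Local Open Scope classical_set_scope.
Local Open Scope ring_scope.

(* Classical tensor calculus: tensors are families of components, one for each
   chart, related by the usual transformation laws. Tangent vectors are row
   vectors; the components of a bilinear form are a square matrix. *)

Section LocalCalculus.
Context {R : realType} {n : nat}.
Implicit Types (U : set 'rV[R]_n) (f : 'rV[R]_n -> R) (x X Y Z : 'rV[R]_n).

Definition pderiv (i : 'I_n) f : 'rV[R]_n -> R :=
  fun x => 'D_(delta_mx 0 i) f x.

Fixpoint Ck (k : nat) U f : Prop :=
  if k is k'.+1 then
    (forall x, U x -> differentiable f x) /\
    forall i, Ck k' U (pderiv i f)
  else forall x, U x -> {for x, continuous f}.

(* C^infinity on U; only used for open U. *)
Definition smooth_on U f : Prop := forall k, Ck k U f.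

Definition inner (A : 'M[R]_n) X Y : R := (X *m A *m Y^T) 0 0.

Implicit Type g : 'rV[R]_n -> 'M[R]_n.

(* Gamma^k_ij of the Levi-Civita connection of g. *)
Definition christoffel g (k i j : 'I_n) : 'rV[R]_n -> R := fun x =>
  2^-1 * \sum_l invmx (g x) k l *
    (pderiv i (fun y => g y j l) x + pderiv j (fun y => g y i l) x
     - pderiv l (fun y => g y i j) x).

(* Gamma(X, Y): the covariant derivative at x of a vector field Y along a curve
   with velocity X is Y' + Gamma(X, Y). *)
Definition christoffel_form g x X Y : 'rV[R]_n :=
  \row_k \sum_i \sum_j christoffel g k i j x * X 0 i * Y 0 j.

(* R(d_i, d_j) d_k = \sum_l (riemann g l i j k) d_l, with
   R(X, Y) = nabla_X nabla_Y - nabla_Y nabla_X - nabla_[X, Y]. *)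
Definition riemann g (l i j k : 'I_n) : 'rV[R]_n -> R := fun x =>
  pderiv i (christoffel g l j k) x - pderiv j (christoffel g l i k) x
  + \sum_m (christoffel g m j k x * christoffel g l i m x
            - christoffel g m i k x * christoffel g l j m x).

Definition curvature g x X Y Z : 'rV[R]_n :=
  \row_l \sum_i \sum_j \sum_k riemann g l i j k x * X 0 i * Y 0 j * Z 0 k.

Definition sectional g x X Y : R :=
  inner (g x) (curvature g x X Y Y) X /
  (inner (g x) X X * inner (g x) Y Y - inner (g x) X Y ^+ 2).

(* These symbols do define the Levi-Civita connection: it is torsion-free and
   g is parallel. *)

Lemma pderiv_sym g x i j l : (\forall y \near x, (g y)^T = g y) ->
  pderiv l (fun y => g y i j) x = pderiv l (fun y => g y j i) x.
Proof.
move=> gS; apply: near_eq_derive.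
by near=> y; rewrite -[in LHS](near gS y)// mxE.
Unshelve. all: by end_near. Qed.

Lemma christoffel_torsion_free g x k i j : (\forall y \near x, (g y)^T = g y) ->
  christoffel g k i j x = christoffel g k j i x.
Proof.
move=> gS; rewrite /christoffel; congr (_ * _); apply: eq_bigr => l _.
by rewrite (pderiv_sym i j l gS) [X in X - _]addrC.
Qed.

Lemma christoffel_lower g x i j m :
    (\forall y \near x, (g y)^T = g y) -> g x \in unitmx ->
  \sum_l christoffel g l i j x * g x l m =
  2^-1 * (pderiv i (fun y => g y j m) x + pderiv j (fun y => g y i m) x
          - pderiv m (fun y => g y i j) x).
Proof.
move=> gS gU; rewrite /christoffel.
pose F l := pderiv i (fun y => g y j l) x + pderiv j (fun y => g y i l) x
            - pderiv l (fun y => g y i j) x.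
under eq_bigr do rewrite -mulrA.
rewrite -mulr_sumr; congr (_ * _); rewrite -[RHS]/(F m).
have gxS : (g x)^T = g x by apply: nbhs_singleton gS.
have giS a b : invmx (g x) a b = invmx (g x) b a.
  by rewrite -[in LHS]gxS -trmx_inv mxE.
under eq_bigr do rewrite mulr_suml.
rewrite exchange_big /= (bigD1 m)//= [X in _ + X]big1 => [|l lm].
- rewrite addr0; under eq_bigr do rewrite giS mulrAC.
  rewrite -mulr_suml; have := mulVmx gU => /matrixP/(_ m m).
  by rewrite !mxE eqxx => ->; rewrite mul1r.
- under eq_bigr do rewrite giS mulrAC.
  rewrite -mulr_suml; have := mulVmx gU => /matrixP/(_ l m).
  by rewrite !mxE (negbTE lm) => ->; rewrite mul0r.
Qed.

Lemma christoffel_metric g x i j k :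
    (\forall y \near x, (g y)^T = g y) -> g x \in unitmx ->
  pderiv k (fun y => g y i j) x =
  \sum_l christoffel g l k i x * g x l j
  + \sum_l christoffel g l k j x * g x i l.
Proof.
move=> gS gU; have gxS : (g x)^T = g x by apply: nbhs_singleton gS.
have giS l : g x i l = g x l i by rewrite -[in LHS]gxS mxE.
under [X in _ + X]eq_bigr do rewrite giS.
rewrite !christoffel_lower// -mulrDr (pderiv_sym j i k gS).
set a := pderiv k _ _; set b := pderiv i _ _; set c := pderiv j _ _.
have -> : a + b - c + (a + c - b) = 2 * a by ring.
by rewrite mulrA mulVf ?mul1r// pnatr_eq0.
Qed.

End LocalCalculus.

(* A set of points with a family of charts to R^n. *)
Record atlas (R : realType) (n : nat) := Atlas {
  mpoint : Type;
  chart : Type;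
  chart_dom : chart -> set mpoint;
  chart_coord : chart -> mpoint -> 'rV[R]_n }.

Section Manifolds.
Context {R : realType} {n : nat}.
Implicit Type M : atlas R n.

Definition chart_image M (a : chart M) : set 'rV[R]_n :=
  chart_coord a @` chart_dom a.

Definition overlap M (a b : chart M) : set 'rV[R]_n :=
  chart_coord a @` (chart_dom a `&` chart_dom b).

(* chart_coord b \o (chart_coord a)^-1 on overlap a b, 0 elsewhere. *)
Definition transition M (a b : chart M) (x : 'rV[R]_n) : 'rV[R]_n :=
  xget 0 [set chart_coord b p | p in
          chart_dom a `&` chart_dom b `&` chart_coord a @^-1` [set x]].

(* The topology of M. *)
Definition open_in M (U : set (mpoint M)) : Prop :=
  forall a : chart M, open (chart_coord a @` (chart_dom a `&` U)).

Record is_manifold M : Prop := IsManifold {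
  manifold_nonempty : [set: mpoint M] !=set0;
  charts_cover : forall p : mpoint M, exists a, chart_dom a p;
  coord_inj : forall a : chart M, set_inj (chart_dom a) (chart_coord a);
  overlap_open : forall a b : chart M, open (overlap a b);
  transition_smooth : forall (a b : chart M) i,
    smooth_on (overlap a b) (fun x => transition a b x 0 i);
  manifold_hausdorff : forall p q : mpoint M, p <> q ->
    exists U V, [/\ open_in U, open_in V, U p, V q & U `&` V = set0];
  manifold_second_countable : exists B : nat -> set (mpoint M),
    (forall k, open_in (B k)) /\
    forall U p, open_in U -> U p -> exists2 k, B k p & B k `<=` U }.

Record riemannian_metric M := RiemannianMetric {
  gmx :> chart M -> 'rV[R]_n -> 'M[R]_n;
  gmx_smooth : forall a i j, smooth_on (chart_image a) (fun x => gmx a x i j);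
  gmx_sym : forall a x, chart_image a x -> (gmx a x)^T = gmx a x;
  gmx_pos : forall a x, chart_image a x ->
    forall X, X != 0 -> 0 < inner (gmx a x) X X;
  gmx_transform : forall a b p, chart_dom a p -> chart_dom b p -> forall X Y,
    inner (gmx b (chart_coord b p)) ('D_X (transition a b) (chart_coord a p))
                                    ('D_Y (transition a b) (chart_coord a p))
    = inner (gmx a (chart_coord a p)) X Y }.

Definition flat M (g : riemannian_metric M) : Prop :=
  forall a p, chart_dom a p -> forall X Y Z,
    curvature (g a) (chart_coord a p) X Y Z = 0.

(* The values of the sectional curvature, over all points p and all planes in
   the tangent space at p, each plane being spanned by independent X and Y. *)
Definition sectional_curvatures M (g : riemannian_metric M) : set R :=
  [set k | exists a p X Y, [/\ chart_dom a p, row_free (col_mx X Y) &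
                               k = sectional (g a) (chart_coord a p) X Y]].

(* A tangent vector at tbase, given by its components in every chart around
   tbase; the value 0 in the other charts makes the representation unique. *)
Record tvector M := TVector {
  tbase : mpoint M;
  tcomp : chart M -> 'rV[R]_n;
  tcomp_transform : forall a b, chart_dom a tbase -> chart_dom b tbase ->
    tcomp b = 'D_(tcomp a) (transition a b) (chart_coord a tbase);
  tcomp_out : forall a, ~ chart_dom a tbase -> tcomp a = 0 }.

Definition tangent_bundle M : atlas R (n + n) := {|
  mpoint := tvector M;
  chart := chart M;
  chart_dom := fun a => [set V | chart_dom a (tbase V)];
  chart_coord := fun a V => row_mx (chart_coord a (tbase V)) (tcomp V a) |}.

Lemma transitionE M (mM : is_manifold M) (a b : chart M) p :
  chart_dom a p -> chart_dom b p ->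
  transition a b (chart_coord a p) = chart_coord b p.
Proof.
move=> ap bp; rewrite /transition; case: xgetP => [y -> [q [[aq bq] /= E] <-]|].
  by congr chart_coord; apply: (coord_inj mM (a := a)) => //; exact: mem_set.
by move=> /(_ (chart_coord b p)) []; exists p.
Qed.

Lemma transition_differentiable M (mM : is_manifold M) (a b : chart M) p :
  chart_dom a p -> chart_dom b p ->
  differentiable (transition a b) (chart_coord a p).
Proof.
move=> ap bp; have xU : overlap a b (chart_coord a p) by exists p.
have -> : transition a b =
    (fun x => \sum_(i < n) transition a b x 0 i *: delta_mx 0 i).
  by apply/funext => x; rewrite [LHS]row_sum_delta.
have D i : differentiable (fun x => transition a b x 0 i) (chart_coord a p).
  by have [+ _] := transition_smooth mM a b i 1%N; apply.
have -> : (fun x => \sum_(i < n) transition a b x 0 i *: delta_mx 0 i) =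
    \sum_(i < n) (fun x => transition a b x 0 i *: (delta_mx 0 i : 'rV[R]_n)).
  by apply/funext => x; rewrite fct_sumE.
by apply: differentiable_sum => i; apply: differentiableZl.
Qed.

(* Every row vector gives the components in a chart of a tangent vector. *)
Lemma tvector_exists M (mM : is_manifold M) (a : chart M) p (y : 'rV[R]_n) :
  chart_dom a p -> exists V : tvector M, tbase V = p /\ tcomp V a = y.
Proof.
move=> ap; pose x := chart_coord a p.
pose c (b : chart M) : 'rV[R]_n :=
  if pselect (chart_dom b p) then 'D_y (transition a b) x else 0.
have cE b : chart_dom b p -> c b = 'D_y (transition a b) x.
  by move=> bp; rewrite /c; case: pselect.
have nearU b d : chart_dom b p -> chart_dom d p ->
    \forall z \near x, exists2 q, chart_coord a q = z &
      [/\ chart_dom a q, chart_dom b q & chart_dom d q].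
  move=> bp dp.
  have ob : overlap a b x by exists p.
  have od : overlap a d x by exists p.
  near=> z.
  have : overlap a b z.
    by near: z; apply: open_nbhs_nbhs; split=> //; exact: overlap_open.
  have : overlap a d z.
    by near: z; apply: open_nbhs_nbhs; split=> //; exact: overlap_open.
  move=> [q [aq dq] qz] [r [ar br] rz]; exists q => //; split => //.
  rewrite (_ : q = r)//; apply: (coord_inj mM (a := a)); rewrite ?inE//.
  by rewrite qz rz.
have ca : c a = y.
  rewrite cE// (@near_eq_derive _ _ _ _ id); first by rewrite derive_id.
  near=> z; have [//|q <- [aq _ _]] := near (nearU a a ap ap) z.
  by rewrite transitionE.
have ctrans b d : chart_dom b p -> chart_dom d p ->
    c d = 'D_(c b) (transition b d) (chart_coord b p).
  move=> bp dp; rewrite !cE//.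
  have -> : 'D_y (transition a d) x = 'D_y (transition b d \o transition a b) x.
    apply: near_eq_derive; near=> z.
    have [//|q <- [aq bq dq]] := near (nearU b d bp dp) z.
    by rewrite /= !transitionE.
  have Dab := transition_differentiable mM ap bp.
  have Dbd := transition_differentiable mM bp dp.
  have xb : chart_coord b p = transition a b x by rewrite transitionE.
  rewrite xb in Dbd *.
  rewrite !deriveE//; last exact: differentiable_comp.
  have E := diff_comp Dab Dbd.
  have E' := congr1 (fun h : 'rV[R]_n -> 'rV[R]_n => h y) E.
  exact: E'.
have cout b : ~ chart_dom b p -> c b = 0 by rewrite /c; case: pselect.
by exists (TVector ctrans cout).
Unshelve. all: by end_near. Qed.

End Manifolds.

Section NaturalMetrics.
Context {R : realType} {n : nat} {M : atlas R n}.
Variables (g : riemannian_metric M) (G : riemannian_metric (tangent_bundle M)).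

(* In the chart of TM induced by a chart a of M, with coordinates
   row_mx (chart_coord a (tbase V)) (tcomp V a) at V, the components of a vector
   tangent to TM at V form a row W : 'rV_(n + n). *)

Definition dproj (W : 'rV[R]_(n + n)) : 'rV[R]_n := lsubmx W.

(* If W is the velocity at 0 of a curve Y in TM with Y(0) = V, this is the
   covariant derivative (nabla Y / ds)(0). *)
Definition kappa (a : chart M) (V : tvector M) (W : 'rV[R]_(n + n)) :
    'rV[R]_n :=
  rsubmx W
  + christoffel_form (g a) (chart_coord a (tbase V)) (dproj W) (tcomp V a).

Definition Gmx (a : chart M) (V : tvector M) : 'M[R]_(n + n) :=
  G a (@chart_coord _ _ (tangent_bundle M) a V).

(* The rows of u are an orthonormal basis of the tangent space of M at the base
   point of V, and V = \sum_i xi_i u_i. *)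
Definition frame_at (a : chart M) (V : tvector M) (u : 'M[R]_n)
    (xi : 'rV[R]_n) : Prop :=
  [/\ chart_dom a (tbase V),
      u *m g a (chart_coord a (tbase V)) *m u^T = 1%:M &
      tcomp V a = xi *m u].

(* The rows of e are the vectors e_1, ..., e_2n of (TM)_V defined by u. *)
Definition lifted_frame (a : chart M) (V : tvector M) (u : 'M[R]_n)
    (e : 'M[R]_(n + n)) : Prop :=
  forall i : 'I_n,
    [/\ dproj (row (lshift n i) e) = row i u,
        kappa a V (row (lshift n i) e) = 0,
        dproj (row (rshift n i) e) = 0 &
        kappa a V (row (rshift n i) e) = row i u].

Definition gram (a : chart M) (V : tvector M) (e : 'M[R]_(n + n)) :
  'M[R]_(n + n) := e *m Gmx a V *m e^T.

Definition riemannian_submersion : Prop :=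
  forall a V, chart_dom a (tbase V) -> forall W W',
    (forall Z, dproj Z = 0 ->
       inner (Gmx a V) W Z = 0 /\ inner (Gmx a V) W' Z = 0) ->
    inner (Gmx a V) W W'
    = inner (g a (chart_coord a (tbase V))) (dproj W) (dproj W').

Definition natural_metric : Prop :=
  [/\ riemannian_submersion,
      forall a V, chart_dom a (tbase V) -> forall W Z,
        kappa a V W = 0 -> dproj Z = 0 -> inner (Gmx a V) W Z = 0 &
      exists A : 'rV[R]_n -> 'M[R]_(n + n), forall a V u xi e,
        frame_at a V u xi -> lifted_frame a V u e -> gram a V e = A xi].

(* C^infinity on [0, +oo[, that is, the restriction of a smooth function. *)
Definition smooth_halfline (f : R -> R) : Prop :=
  exists2 h : R -> R, (forall k t, derivable (derive1n k h) t 1) &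
    forall t, 0 <= t -> f t = h t.

Definition characterized_by (alpha beta : R -> R) : Prop :=
  [/\ smooth_halfline alpha, smooth_halfline beta,
      forall t, 0 <= t -> 0 < alpha t /\ 0 < alpha t + t * beta t &
      forall a V u xi e, frame_at a V u xi -> lifted_frame a V u e ->
        let t := \sum_i xi 0 i ^+ 2 in
        forall i j : 'I_n,
          [/\ gram a V e (lshift n i) (lshift n j) = (i == j)%:R,
              gram a V e (lshift n i) (rshift n j) = 0 &
              gram a V e (rshift n i) (rshift n j)
              = alpha t * (i == j)%:R + beta t * xi 0 i * xi 0 j]].

End NaturalMetrics.

(* Main.v *)
(* Write x for the base point and y for the vector at a point z of TM. In the
   splitting into horizontal and vertical parts, G(W, W') at z is
   g(pi W, pi W') + Q(kappa W, kappa W'), where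
   Q(v, w) = alpha(|y|^2) g(v, w) + beta(|y|^2) g(y, v) g(y, w).
   Extend the horizontal lift of X at z to the vector field X^h with constant
   components in the chart: its kappa-component vanishes at z, so the curvature
   of G on horizontal planes involves only the first derivatives P(X, Y) of
   kappa(Y^h) along X^h, and P(X, Y) - P(Y, X) = R(X, Y)y. This yields
     <R(X^h, Y^h)Y^h, X^h> = <R(X, Y)Y, X> - 3/4 Q(R(X, Y)y, R(X, Y)y),
   where the last term is 3/4 alpha(|y|^2) |R(X, Y)y|^2 as R(X, Y)y is orthogonal
   to y. On the zero section it vanishes, so that every value of K is a value of
   the curvature of TM: this is (iv). Letting |y| tend to infinity gives (iii).
   Along the zero section, mixed planes spanned by a horizontal and a vertical
   vector have curvature 0: this gives (i), shows that a constant curvature of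
   TM can only be 0, and hence gives (ii) by polarization and (iv). *)
Require Import Defs.
From mathcomp Require Import all_boot all_order all_algebra.
From mathcomp Require Import all_classical all_reals all_analysis.
From mathcomp Require Import ring lra.
Import Order.TTheory GRing.Theory Num.Theory.
Import numFieldNormedType.Exports.
Local Open Scope classical_set_scope.
Local Open Scope ring_scope.

Set Implicit Arguments.
Unset Strict Implicit.
Unset Printing Implicit Defensive.

(** * Smooth functions *)

(** The first-order expansion of [f] at [x] only involves values near [x], so it is also one of [h];
    uniqueness of the differential then identifies ['d h x] with ['d f x]. *)
Lemma differentiable_ext_on (R : numFieldType) (V W : normedModType R)
    (U : set V) (f h : V -> W) (x : V) :
  open U -> (forall x, U x -> f x = h x) ->
  U x -> differentiable f x -> differentiable h x.
Proof.
move=> oU fh Ux df; apply/diff_locallyP.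
have nU : \forall y \near (0 : V), U (y + x).
  have : nbhs x U by exact: open_nbhs_nbhs.
  rewrite [nbhs x U](near_shift 0 x U) => UE.
  by apply: filterS UE => y /=; rewrite subr0.
have fhx : h \o shift x = cst (h x) + 'd f x +o_ 0 id.
  move: (df) => /diff_locallyP[_] /eqaddoP E; apply/eqaddoP => e e0.
  apply: filterS2 nU (E _ e0) => y Uy.
  rewrite !fctE /= (fh x)// fh//.
have cf : continuous ('d f x) by exact: diff_continuous.
by rewrite (diff_unique cf fhx).
Qed.

(** The two difference quotients are literally the same function of [t], so the equality of
    derivatives requires no chain rule. It serves for lines, translations, coordinates, projections
    and the zero section. *)
Lemma derive_comp_affine (R : numFieldType) (V W X : normedModType R)
    (L : V -> W) (f : W -> X) (z v : V) (w : W) :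
  (forall t : R, L (t *: v + z) = t *: w + L z) ->
  'D_v (f \o L) z = 'D_w f (L z).
Proof.
move=> E; rewrite /derive.
have -> // : (fun t : R => t^-1 *: (((f \o L) \o shift z) (t *: v) - (f \o L) z)) =
             (fun t => t^-1 *: ((f \o shift (L z)) (t *: w) - f (L z))).
by apply/funext => t /=; rewrite E.
Qed.

Lemma derivable_comp_affine (R : numFieldType) (V W X : normedModType R)
    (L : V -> W) (f : W -> X) (z v : V) (w : W) :
  (forall t : R, L (t *: v + z) = t *: w + L z) ->
  derivable f (L z) w -> derivable (f \o L) z v.
Proof.
move=> E; rewrite /derivable.
have -> // : (fun t : R => t^-1 *: ((f \o shift (L z)) (t *: w) - f (L z))) =
             (fun t => t^-1 *: (((f \o L) \o shift z) (t *: v) - (f \o L) z)).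
by apply/funext => t /=; rewrite E.
Qed.

(** * Mean value theorem along lines and symmetry of second derivatives *)

Section DirectionalDerivatives.
Context {R : realType} {V : normedModType R}.
Implicit Types (f : V -> R) (x v : V).

Lemma line_shift x v (h s : R) :
  (h *: (1 : R) + s) *: v + x = h *: v + (s *: v + x).
Proof. by rewrite addrA -scalerDl /GRing.scale /= mulr1. Qed.

Lemma mean_value_line f x v (t : R) : 0 <= t ->
    (forall s, 0 <= s <= t -> derivable f (s *: v + x) v) ->
  exists2 s, 0 <= s <= t & f (t *: v + x) - f x = t * 'D_v f (s *: v + x).
Proof.
move=> t0 df; pose F s := f (s *: v + x).
have dF (s : R) : 0 <= s <= t -> is_derive s 1 F ('D_v f (s *: v + x)).
  move=> st; have L h : (fun s : R => s *: v + x) (h *: (1 : R) + s)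
      = h *: v + (fun s => s *: v + x) s by exact: line_shift.
  have /= <- := derive_comp_affine (L := (fun s : R => s *: v + x)) f L.
  by apply/derivableP/(derivable_comp_affine (L := (fun s : R => s *: v + x)) L)/df.
have cF : {within `[0, t], continuous F}.
  apply: derivable_within_continuous => s; rewrite in_itv /= => st.
  by have [] := dF s st.
have dF' (s : R) : s \in `]0, t[ -> is_derive s 1 F ('D_v f (s *: v + x)).
  by rewrite in_itv /= => /andP[s0 st]; apply: dF; rewrite !ltW.
have [s] := MVT_segment t0 dF' cF.
rewrite in_itv /= => st; rewrite /F scale0r add0r subr0 mulrC => E.
by exists s.
Qed.

(* The second difference of [f] over a small parallelogram is, by two applications
   of the mean value theorem in either order, [d ^+ 2] times a value of [A] and
   [d ^+ 2] times a value of [B] near [x]. *)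
Lemma derive_swap (U : set V) f (A B : V -> R) (u v x : V) : open U -> U x ->
    (forall y, U y -> derivable f y u) -> (forall y, U y -> derivable f y v) ->
    (forall y, U y -> is_derive y v ('D_u f) (A y)) ->
    (forall y, U y -> is_derive y u ('D_v f) (B y)) ->
    {for x, continuous A} -> {for x, continuous B} -> B x = A x.
Proof.
move=> oU Ux fu fv fuv fvu cA cB.
apply/eqP; rewrite -subr_eq0 -normr_le0; apply/ler_addgt0Pl => e e0; rewrite addr0.
have e2 : 0 < e / 2 by rewrite divr_gt0.
have /nbhs_normP[r /= r0 rP] : \forall y \near x,
    [/\ U y, `|A x - A y| <= e / 2 & `|B x - B y| <= e / 2].
  have NU := open_nbhs_nbhs (conj oU Ux).
  move/cvgrPdist_le : cA => /(_ _ e2) NA; move/cvgrPdist_le : cB => /(_ _ e2) NB.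
  by apply: filterS (filterI NU (filterI NA NB)) => y [? []].
(* With this side the parallelogram stays within distance [r] of [x]; the [+ 1] gives the strict
   bound and covers [u = v = 0]. *)
pose d := r / (`|u| + `|v| + 1).
have N0 : 0 < `|u| + `|v| + 1 by rewrite ltr_wpDl ?addr_ge0.
have d0 : 0 < d by rewrite divr_gt0.
have box s t : 0 <= s <= d -> 0 <= t <= d ->
    [/\ U (s *: u + (t *: v + x)), `|A x - A (s *: u + (t *: v + x))| <= e / 2 &
        `|B x - B (s *: u + (t *: v + x))| <= e / 2].
  move=> /andP[s0 sd] /andP[t0 td]; apply: rP; rewrite /ball_ /=.
  rewrite distrC addrA addrK.
  apply: le_lt_trans (ler_normD _ _) _; rewrite !normrZ !ger0_norm//.
  apply: (@le_lt_trans _ _ (d * (`|u| + `|v|))).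
    by rewrite mulrDr lerD// ler_wpM2r.
  by rewrite /d mulrAC ltr_pdivrMr// ltr_pM2l// ltrDl.
have box' s t : 0 <= s <= d -> 0 <= t <= d -> U (t *: v + (s *: u + x)).
  by move=> sd td; rewrite addrCA; case: (box s t).
have dd : 0 <= d <= d by rewrite lexx ltW.
have zd : 0 <= (0 : R) <= d by rewrite lexx ltW.
have d00 : 0 <= d by exact: ltW.
have [p pd Ep] : exists2 p, exists s t, [/\ 0 <= s <= d, 0 <= t <= d &
    p = s *: u + (t *: v + x)] &
    f (d *: u + (d *: v + x)) - f (d *: v + x) - (f (d *: u + x) - f x)
    = d * (d * A p).
  pose F y := f (d *: v + y) - f y.
  (* The first mean value is taken along [u] for the increment of [f] in the direction [d *: v], the
     second along [v] for ['D_u f]. *)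
  have DF s : 0 <= s <= d -> is_derive (s *: u + x) u F
      ('D_u f (d *: v + (s *: u + x)) - 'D_u f (s *: u + x)).
    move=> sd; apply: is_deriveB; last first.
      by apply/derivableP/fu; have := box' s 0 sd zd; rewrite scale0r add0r.
    have L (h : R) : (fun y => d *: v + y) (h *: u + (s *: u + x)) =
        h *: u + (fun y => d *: v + y) (s *: u + x) by exact: addrCA.
    have /= <- := derive_comp_affine (L := (fun y => d *: v + y)) f L.
    apply/derivableP/(derivable_comp_affine (L := (fun y => d *: v + y)) L).
    by apply/fu/box'.
  have [s sd] := mean_value_line d00
    (fun s sd => @ex_derive _ _ _ _ _ _ _ (DF s sd)).
  have [_ ->] := DF s sd.
  have [t td ->] := mean_value_line (f := 'D_u f) (x := s *: u + x) (v := v) d00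
    (fun t td => @ex_derive _ _ _ _ _ _ _ (fuv _ (box' s t sd td))).
  rewrite (@derive_val _ _ _ _ _ _ _ (fuv _ (box' s t sd td))) /F => E.
  exists (t *: v + (s *: u + x)).
    by exists s, t; split=> //; rewrite addrCA.
  rewrite -E [d *: v + (d *: u + x)]addrCA; ring.
have [q qd Eq] : exists2 q, exists s t, [/\ 0 <= s <= d, 0 <= t <= d &
    q = s *: u + (t *: v + x)] &
    f (d *: u + (d *: v + x)) - f (d *: v + x) - (f (d *: u + x) - f x)
    = d * (d * B q).
  pose F y := f (d *: u + y) - f y.
  have DF s : 0 <= s <= d -> is_derive (s *: v + x) v F
      ('D_v f (d *: u + (s *: v + x)) - 'D_v f (s *: v + x)).
    move=> sd; apply: is_deriveB; last first.
      by apply/derivableP/fv; have := box' 0 s zd sd; rewrite scale0r add0r.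
    have L (h : R) : (fun y => d *: u + y) (h *: v + (s *: v + x)) =
        h *: v + (fun y => d *: u + y) (s *: v + x) by exact: addrCA.
    have /= <- := derive_comp_affine (L := (fun y => d *: u + y)) f L.
    apply/derivableP/(derivable_comp_affine (L := (fun y => d *: u + y)) L).
    by apply: fv; case: (box d s).
  have [s sd] := mean_value_line d00
    (fun s sd => @ex_derive _ _ _ _ _ _ _ (DF s sd)).
  have [_ ->] := DF s sd.
  have bx t : 0 <= t <= d -> U (t *: u + (s *: v + x)).
    by move=> td; case: (box t s).
  have [t td ->] := mean_value_line (f := 'D_v f) (x := s *: v + x) (v := u) d00
    (fun t td => @ex_derive _ _ _ _ _ _ _ (fvu _ (bx t td))).
  rewrite (@derive_val _ _ _ _ _ _ _ (fvu _ (bx t td))) /F => E.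
  exists (t *: u + (s *: v + x)); first by exists t, s.
  by rewrite -E; ring.
have Apq : A p = B q.
  by move: Eq; rewrite Ep => /(mulfI (lt0r_neq0 d0))/(mulfI (lt0r_neq0 d0)).
have [s [t [sd td pE]]] := pd; have [s' [t' [sd' td' qE]]] := qd.
have [_ HA _] := box s t sd td; have [_ _ HB] := box s' t' sd' td'.
rewrite -pE in HA; rewrite -qE in HB.
have -> : B x - A x = (B x - B q) - (A x - A p) by rewrite Apq; ring.
by rewrite (le_trans (ler_normB _ _))// [e]splitr lerD.
Qed.

End DirectionalDerivatives.

(** * Calculus of smooth functions on open sets *)

Section SmoothFunctions.
Context {R : realType} {n : nat}.
Implicit Types (U : set 'rV[R]_n) (f h : 'rV[R]_n -> R) (x v : 'rV[R]_n).

Lemma derive_ext_on U f h v : open U -> (forall x, U x -> f x = h x) ->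
  forall x, U x -> 'D_v f x = 'D_v h x.
Proof.
move=> oU fh x Ux; apply: near_eq_derive.
by near=> y; apply: fh; near: y; exact: open_nbhs_nbhs.
Unshelve. all: by end_near. Qed.

Lemma Ck_ext k U f h : open U -> (forall x, U x -> f x = h x) ->
  Ck k U f -> Ck k U h.
Proof.
move=> oU; elim: k f h => [|k IH] f h fh /=.
  move=> cf x Ux; have := cf x Ux; rewrite /prop_for /continuous_at -(fh x)//.
  have hfx : \forall y \near x, f y = h y.
    by near=> y; rewrite fh//; near: y; exact: open_nbhs_nbhs.
  exact: cvg_trans (near_eq_cvg hfx).
move=> [df ckf]; split=> [x Ux|i].
  exact: differentiable_ext_on oU fh Ux (df x Ux).
by apply: IH (ckf i) => x Ux; exact: derive_ext_on oU fh x Ux.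
Unshelve. all: by end_near. Qed.

Lemma CkW k U f : Ck k.+1 U f -> Ck k U f.
Proof.
elim: k f => [|k IH] f /= [df ckf].
  by move=> x Ux; exact/differentiable_continuous/df.
by split=> // i; apply: IH; exact: ckf.
Qed.

Lemma smooth_on_differentiable U f x :
  smooth_on U f -> U x -> differentiable f x.
Proof. by move=> /(_ 1%N)[df _]; exact: df. Qed.

Lemma smooth_on_derivable U f x v : smooth_on U f -> U x -> derivable f x v.
Proof. by move=> sf Ux; exact/diff_derivable/(smooth_on_differentiable sf Ux). Qed.

Lemma smooth_on_pderiv U f i : smooth_on U f -> smooth_on U (pderiv i f).
Proof. by move=> sf k; have [_] := sf k.+1; exact. Qed.

Lemma smooth_on_ext U f h : open U -> (forall x, U x -> f x = h x) ->
  smooth_on U f -> smooth_on U h.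
Proof. by move=> oU fh sf k; exact: Ck_ext (sf k). Qed.

Lemma derive_pderiv f x v : differentiable f x ->
  'D_v f x = \sum_i v 0 i * pderiv i f x.
Proof.
move=> df; rewrite deriveE// [v in LHS]row_sum_delta linear_sum.
by apply: eq_bigr => i _; rewrite linearZ /pderiv deriveE.
Qed.

Lemma pderivD i f h x : differentiable f x -> differentiable h x ->
  pderiv i (fun y => f y + h y) x = pderiv i f x + pderiv i h x.
Proof. by move=> df dh; rewrite /pderiv deriveD//; exact: diff_derivable. Qed.

Lemma pderivM i f h x : differentiable f x -> differentiable h x ->
  pderiv i (fun y => f y * h y) x = f x * pderiv i h x + pderiv i f x * h x.
Proof.
move=> df dh; rewrite /pderiv deriveM//; try exact: diff_derivable.
by rewrite /GRing.scale /= [in X in _ + X]mulrC.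
Qed.

Lemma Ck_cst k U (c : R) : Ck k U (fun=> c).
Proof.
elim: k c => [|k IH] c /=; first by move=> x _; exact: cst_continuous.
split=> [x _|i]; first exact: differentiable_cst.
have -> : pderiv i (fun _ : 'rV[R]_n => c) = fun=> 0; last exact: IH.
by apply/funext => x; rewrite /pderiv derive_cst.
Qed.

Lemma CkD k U f h : open U -> Ck k U f -> Ck k U h ->
  Ck k U (fun x => f x + h x).
Proof.
move=> oU; elim: k f h => [|k IH] f h /=.
  by move=> cf ch x Ux; apply: continuousD; [exact: cf|exact: ch].
move=> [df cf] [dh ch]; split=> [x Ux|i].
  by apply: differentiableD; [exact: df|exact: dh].
apply: Ck_ext oU _ (IH _ _ (cf i) (ch i)) => x Ux.
by rewrite pderivD//; [exact: df|exact: dh].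
Qed.

Lemma CkM k U f h : open U -> Ck k U f -> Ck k U h ->
  Ck k U (fun x => f x * h x).
Proof.
move=> oU; elim: k f h => [|k IH] f h.
  by move=> /= cf ch x Ux; apply: continuousM; [exact: cf|exact: ch].
move=> cf ch; have cf' := CkW cf; have ch' := CkW ch.
case: cf ch => df cf [dh ch] /=; split=> [x Ux|i].
  by apply: differentiableM; [exact: df|exact: dh].
have := CkD oU (IH _ _ cf' (ch i)) (IH _ _ (cf i) ch').
by apply: Ck_ext oU _ => x Ux; rewrite pderivM//; [exact: df|exact: dh].
Qed.

Lemma CkV k U f : open U -> (forall x, U x -> f x != 0) -> Ck k U f ->
  Ck k U (fun x => (f x)^-1).
Proof.
move=> oU f0; elim: k => [|k IH].
  by move=> /= cf x Ux; apply: continuousV; [exact: f0|exact: cf].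
move=> cf; have ci := IH (CkW cf).
case: cf => df cf /=; split=> [x Ux|i].
  by apply: differentiableV; [exact: df|exact: f0].
have := CkM oU (CkM oU ci ci) (CkM oU (@Ck_cst k U (-1)) (cf i)).
apply: Ck_ext oU _ => x Ux; rewrite /pderiv deriveV//; last first.
- exact/diff_derivable/df.
- exact: f0.
by rewrite /GRing.scale /= -exprVn; ring.
Qed.

Lemma smooth_on_cst U (c : R) : smooth_on U (fun=> c).
Proof. by move=> k; exact: Ck_cst. Qed.

Lemma smooth_onD U f h : open U -> smooth_on U f -> smooth_on U h ->
  smooth_on U (fun x => f x + h x).
Proof. by move=> oU sf sh k; exact: CkD. Qed.

Lemma smooth_onM U f h : open U -> smooth_on U f -> smooth_on U h ->
  smooth_on U (fun x => f x * h x).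
Proof. by move=> oU sf sh k; exact: CkM. Qed.

Lemma smooth_onN U f : open U -> smooth_on U f -> smooth_on U (fun x => - f x).
Proof.
move=> oU sf; have := smooth_onM oU (@smooth_on_cst U (-1)) sf.
by apply: smooth_on_ext oU _ => x _; rewrite mulN1r.
Qed.

Lemma smooth_onV U f : open U -> (forall x, U x -> f x != 0) -> smooth_on U f ->
  smooth_on U (fun x => (f x)^-1).
Proof. by move=> oU f0 sf k; exact: CkV. Qed.

Lemma smooth_on_sum U (I : Type) (s : seq I) (F : I -> 'rV[R]_n -> R) : open U ->
  (forall i, smooth_on U (F i)) -> smooth_on U (fun x => \sum_(i <- s) F i x).
Proof.
move=> oU sF; elim: s => [|i s IH].
  by apply: smooth_on_ext oU _ (@smooth_on_cst U 0) => x _; rewrite big_nil.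
by apply: smooth_on_ext oU _ (smooth_onD oU (sF i) IH) => x _; rewrite big_cons.
Qed.

Lemma smooth_on_prod U (I : Type) (s : seq I) (F : I -> 'rV[R]_n -> R) : open U ->
  (forall i, smooth_on U (F i)) -> smooth_on U (fun x => \prod_(i <- s) F i x).
Proof.
move=> oU sF; elim: s => [|i s IH].
  by apply: smooth_on_ext oU _ (@smooth_on_cst U 1) => x _; rewrite big_nil.
by apply: smooth_on_ext oU _ (smooth_onM oU (sF i) IH) => x _; rewrite big_cons.
Qed.

Lemma smooth_on_derive U f v : open U -> smooth_on U f -> smooth_on U ('D_v f).
Proof.
move=> oU sf.
have S : smooth_on U (fun x => \sum_i v 0 i * pderiv i f x).
  apply: smooth_on_sum => // i; apply: smooth_onM => //; first exact: smooth_on_cst.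
  exact: smooth_on_pderiv.
apply: smooth_on_ext oU _ S => x Ux.
by rewrite derive_pderiv//; exact: smooth_on_differentiable Ux.
Qed.

Lemma smooth_on_derive_swap U f u v x : open U -> smooth_on U f -> U x ->
  'D_u ('D_v f) x = 'D_v ('D_u f) x.
Proof.
move=> oU sf Ux.
have su := smooth_on_derive u oU sf; have sv := smooth_on_derive v oU sf.
pose A := 'D_v ('D_u f); pose B := 'D_u ('D_v f).
apply: (@derive_swap _ _ U f A B u v x oU Ux) => [y|y|y|y||].
- exact: smooth_on_derivable.
- exact: smooth_on_derivable.
- by move=> Uy; apply/derivableP; exact: smooth_on_derivable Uy.
- by move=> Uy; apply/derivableP; exact: smooth_on_derivable Uy.
- exact: (smooth_on_derive v oU su 0%N).
- exact: (smooth_on_derive u oU sv 0%N).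
Qed.

Lemma smooth_on_coord U i : open U -> smooth_on U (fun x => x 0 i).
Proof.
move=> oU [|k] /=; first by move=> x _; exact: coord_continuous.
split=> [x _|j]; first exact: differentiable_coord.
have := @Ck_cst k U ((delta_mx 0 j : 'rV[R]_n) 0 i).
apply: Ck_ext oU _ => x _; rewrite /pderiv.
have L (t : R) :
    (t *: delta_mx 0 j + x) 0 i = t * (delta_mx 0 j : 'rV[R]_n) 0 i + x 0 i.
  by rewrite !mxE.
have /= -> := derive_comp_affine (W := R) (L := fun y : 'rV[R]_n => y 0 i) id L.
by rewrite derive_id.
Qed.

End SmoothFunctions.

(** A partial derivative of [f \o lsubmx] is the derivative of [f] along the projected basis vector,
    composed with [lsubmx] again. The induction therefore runs over all smooth [f] at once. *)
Lemma smooth_on_lsubmx (R : realType) (n m : nat) (U : set 'rV[R]_n)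
    (f : 'rV[R]_n -> R) : open U -> smooth_on U f ->
  smooth_on (lsubmx @^-1` U) (fun z : 'rV[R]_(n + m) => f (lsubmx z)).
Proof.
move=> oU sf k; elim: k f sf => [|k IH] f sf /=.
  move=> z Uz; apply: differentiable_continuous.
  apply: differentiable_comp; first exact: differentiable_lsubmx.
  exact: smooth_on_differentiable Uz.
split=> [z Uz|i].
  apply: differentiable_comp; first exact: differentiable_lsubmx.
  exact: smooth_on_differentiable Uz.
have := IH _ (smooth_on_derive (lsubmx (delta_mx 0 i : 'rV[R]_(n + m))) oU sf).
congr Ck; apply/funext => z; apply/esym.
by apply: derive_comp_affine => t; rewrite linearP.
Qed.

Lemma open_lsubmx_preimage (R : realType) (n m : nat) (U : set 'rV[R]_n) :
  open U -> open ((lsubmx : 'rV[R]_(n + m) -> 'rV[R]_n) @^-1` U).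
Proof.
move=> oU; apply: open_comp => // z _.
exact/differentiable_continuous/differentiable_lsubmx.
Qed.

(** * Entrywise derivatives of matrix-valued functions *)

Section SmoothMatrices.
Context {R : realType} {N : nat}.
Variable (U : set 'rV[R]_N).
Hypothesis oU : open U.
Implicit Types (v z : 'rV[R]_N).

Definition smooth_mx p q (F : 'rV[R]_N -> 'M[R]_(p, q)) :=
  forall i j, smooth_on U (fun z => F z i j).

Definition Dmx v p q (F : 'rV[R]_N -> 'M[R]_(p, q)) z : 'M[R]_(p, q) :=
  \matrix_(i, j) 'D_v (fun w => F w i j) z.

Lemma Dmx_ext v p q (F H : 'rV[R]_N -> 'M[R]_(p, q)) z :
  (forall z, U z -> F z = H z) -> U z -> Dmx v F z = Dmx v H z.
Proof.
move=> FH Uz; apply/matrixP => i j; rewrite !mxE.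
by apply: derive_ext_on oU _ z Uz => w Uw; rewrite FH.
Qed.

Lemma smooth_mx_cst p q (A : 'M[R]_(p, q)) : smooth_mx (fun=> A).
Proof. by move=> i j; exact: smooth_on_cst. Qed.

Lemma Dmx_cst v p q (A : 'M[R]_(p, q)) z : Dmx v (fun=> A) z = 0.
Proof. by apply/matrixP => i j; rewrite !mxE derive_cst. Qed.

Lemma smooth_mxD p q (F H : 'rV[R]_N -> 'M[R]_(p, q)) :
  smooth_mx F -> smooth_mx H -> smooth_mx (fun z => F z + H z).
Proof.
move=> sF sH i j.
by apply: smooth_on_ext oU _ (smooth_onD oU (sF i j) (sH i j)) => z _; rewrite mxE.
Qed.

Lemma smooth_mxM p q r (F : 'rV[R]_N -> 'M[R]_(p, q))
    (H : 'rV[R]_N -> 'M[R]_(q, r)) :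
  smooth_mx F -> smooth_mx H -> smooth_mx (fun z => F z *m H z).
Proof.
move=> sF sH i j.
have S : smooth_on U (fun z => \sum_k F z i k * H z k j).
  by apply: smooth_on_sum => // k; exact: smooth_onM.
by apply: smooth_on_ext oU _ S => z _; rewrite mxE.
Qed.

Lemma smooth_mxT p q (F : 'rV[R]_N -> 'M[R]_(p, q)) :
  smooth_mx F -> smooth_mx (fun z => (F z)^T).
Proof.
by move=> sF i j; apply: smooth_on_ext oU _ (sF j i) => z _; rewrite mxE.
Qed.

Lemma smooth_mx_derive v p q (F : 'rV[R]_N -> 'M[R]_(p, q)) :
  smooth_mx F -> smooth_mx (Dmx v F).
Proof.
move=> sF i j; apply: smooth_on_ext oU _ (smooth_on_derive v oU (sF i j)) => z _.
by rewrite mxE.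
Qed.

Lemma DmxD v p q (F H : 'rV[R]_N -> 'M[R]_(p, q)) z :
  smooth_mx F -> smooth_mx H -> U z ->
  Dmx v (fun z => F z + H z) z = Dmx v F z + Dmx v H z.
Proof.
move=> sF sH Uz; apply/matrixP => i j; rewrite !mxE.
rewrite -deriveD; [|exact: smooth_on_derivable (sF i j) Uz
                   |exact: smooth_on_derivable (sH i j) Uz].
by apply: derive_ext_on oU _ z Uz => w _; rewrite mxE.
Qed.

Lemma DmxT v p q (F : 'rV[R]_N -> 'M[R]_(p, q)) z :
  Dmx v (fun z => (F z)^T) z = (Dmx v F z)^T.
Proof.
apply/matrixP => i j; rewrite !mxE; congr ('D_v _ z).
by apply/funext => w; rewrite mxE.
Qed.

Lemma DmxM v p q r (F : 'rV[R]_N -> 'M[R]_(p, q))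
    (H : 'rV[R]_N -> 'M[R]_(q, r)) z :
  smooth_mx F -> smooth_mx H -> U z ->
  Dmx v (fun z => F z *m H z) z
  = Dmx v F z *m H z + F z *m Dmx v H z.
Proof.
move=> sF sH Uz; apply/matrixP => i j; rewrite !mxE -big_split /=.
rewrite (@derive_ext_on _ _ U _ (\sum_k (fun w => F w i k * H w k j)) _ oU _ z Uz);
  last by move=> w _; rewrite mxE fct_sumE.
have dF k : derivable (fun w => F w i k) z v.
  exact: smooth_on_derivable (sF i k) Uz.
have dH k : derivable (fun w => H w k j) z v.
  exact: smooth_on_derivable (sH k j) Uz.
rewrite derive_sum => [|k]; last exact: derivableM.
apply: eq_bigr => k _; rewrite deriveM// !mxE addrC; congr (_ + _).
by rewrite mulrC.
Qed.

Lemma DmxMl v p q r (A : 'M[R]_(p, q)) (H : 'rV[R]_N -> 'M[R]_(q, r)) z :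
  smooth_mx H -> U z ->
  Dmx v (fun z => A *m H z) z = A *m Dmx v H z.
Proof.
move=> sH Uz; rewrite (@DmxM _ _ _ _ (fun=> A))//.
  by rewrite Dmx_cst mul0mx add0r.
exact: smooth_mx_cst.
Qed.

Lemma Dmx_swap u v p q (F : 'rV[R]_N -> 'M[R]_(p, q)) z :
  smooth_mx F -> U z ->
  Dmx u (Dmx v F) z = Dmx v (Dmx u F) z.
Proof.
move=> sF Uz; apply/matrixP => i j.
have E u' v' : Dmx u' (Dmx v' F) z i j = 'D_u' ('D_v' (fun w => F w i j)) z.
  rewrite [LHS]mxE; congr ('D_u' _ z); apply/funext => w; exact: mxE.
have S := smooth_on_derive_swap u v oU (sF i j) Uz.
exact: (etrans (E u v) (etrans S (esym (E v u)))).
Qed.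

End SmoothMatrices.

(** * Bilinear forms, their derivatives, and inverse matrices *)

Section Inner.
Context {R : realType} {n : nat}.
Implicit Types (A B : 'M[R]_n) (X Y Z : 'rV[R]_n).

Lemma innerDl A X Y Z : inner A (X + Y) Z = inner A X Z + inner A Y Z.
Proof. by rewrite /inner !mulmxDl mxE. Qed.

Lemma innerDr A X Y Z : inner A X (Y + Z) = inner A X Y + inner A X Z.
Proof. by rewrite /inner linearD mulmxDr mxE. Qed.

Lemma innerZl A (c : R) X Y : inner A (c *: X) Y = c * inner A X Y.
Proof. by rewrite /inner -!scalemxAl mxE. Qed.

Lemma innerZr A (c : R) X Y : inner A X (c *: Y) = c * inner A X Y.
Proof. by rewrite /inner linearZ -scalemxAr mxE. Qed.

Lemma innerNl A X Y : inner A (- X) Y = - inner A X Y.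
Proof. by rewrite -scaleN1r innerZl mulN1r. Qed.

Lemma innerNr A X Y : inner A X (- Y) = - inner A X Y.
Proof. by rewrite -scaleN1r innerZr mulN1r. Qed.

Lemma inner0l A Y : inner A 0 Y = 0.
Proof. by rewrite /inner !mul0mx mxE. Qed.

Lemma inner0r A X : inner A X 0 = 0.
Proof. by rewrite /inner trmx0 mulmx0 mxE. Qed.

Lemma inner_mxD A B X Y : inner (A + B) X Y = inner A X Y + inner B X Y.
Proof. by rewrite /inner mulmxDr mulmxDl mxE. Qed.

Lemma inner_scale_mx (c : R) A X Y : inner (c *: A) X Y = c * inner A X Y.
Proof. by rewrite /inner -scalemxAr -scalemxAl mxE. Qed.

Lemma inner_sym A X Y : A^T = A -> inner A X Y = inner A Y X.
Proof.
move=> AS; rewrite /inner.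
have -> : X *m A *m Y^T = (Y *m A *m X^T)^T by rewrite !trmx_mul trmxK AS mulmxA.
by rewrite mxE.
Qed.

Lemma inner_mulmxl A B X Y : inner A (X *m B) Y = inner (B *m A) X Y.
Proof. by rewrite /inner !mulmxA. Qed.

Lemma inner_mulmxr A B X Y : inner A X (Y *m B) = inner (A *m B^T) X Y.
Proof. by rewrite /inner trmx_mul !mulmxA. Qed.

Lemma inner_pos_unitmx A :
  (forall X, X != 0 -> 0 < inner A X X) -> A \in unitmx.
Proof.
move=> Apos; rewrite -row_free_unit -kermx_eq0; apply/rowV0P => v /sub_kermxP vA.
apply/eqP; apply: contraT => /Apos; by rewrite /inner vA mul0mx mxE ltxx.
Qed.

End Inner.

Section DerivativesOfInner.
Context {R : realType} {N n : nat}.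
Variables (U : set 'rV[R]_N) (oU : open U).
Implicit Types (Q : 'rV[R]_N -> 'M[R]_n) (phi psi : 'rV[R]_N -> 'rV[R]_n).

Lemma smooth_on_inner Q phi psi :
  smooth_mx U Q -> smooth_mx U phi -> smooth_mx U psi ->
  smooth_on U (fun z => inner (Q z) (phi z) (psi z)).
Proof.
move=> sQ sp ss.
exact: (smooth_mxM oU (smooth_mxM oU sp sQ) (smooth_mxT oU ss)).
Qed.

Lemma derive_inner Q phi psi v z :
  smooth_mx U Q -> smooth_mx U phi -> smooth_mx U psi -> U z ->
  'D_v (fun z => inner (Q z) (phi z) (psi z)) z =
  inner (Dmx v Q z) (phi z) (psi z) + inner (Q z) (Dmx v phi z) (psi z)
  + inner (Q z) (phi z) (Dmx v psi z).
Proof.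
move=> sQ sp ss Uz.
have -> : 'D_v (fun z => inner (Q z) (phi z) (psi z)) z =
    Dmx v (fun z => phi z *m Q z *m (psi z)^T) z 0 0 by rewrite mxE.
have spQ := smooth_mxM oU sp sQ; have sT := smooth_mxT oU ss.
rewrite (DmxM oU)// (DmxM oU)// DmxT mxE; congr (_ + _).
by rewrite mulmxDl mxE addrC.
Qed.

End DerivativesOfInner.

Section SmoothInverse.
Context {R : realType} {N : nat}.
Variables (U : set 'rV[R]_N) (oU : open U).

Lemma smooth_on_det n (F : 'rV[R]_N -> 'M[R]_n) :
  smooth_mx U F -> smooth_on U (fun x => \det (F x)).
Proof.
move=> sF; apply: smooth_on_sum => // s; apply: smooth_onM => //.
  exact: smooth_on_cst.
by apply: smooth_on_prod => // i; exact: sF.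
Qed.

(** Cramer's rule: an entry of the inverse is a cofactor divided by the determinant, and both are
    polynomials in the entries. *)
Lemma smooth_mx_invmx n (F : 'rV[R]_N -> 'M[R]_n) :
  smooth_mx U F -> (forall x, U x -> F x \in unitmx) ->
  smooth_mx U (fun x => invmx (F x)).
Proof.
move=> sF Fu k l.
have S : smooth_on U (fun x => (\det (F x))^-1 *
    ((-1) ^+ (l + k) * \det (row' l (col' k (F x))))).
  apply: smooth_onM => //.
    apply: smooth_onV => //; last exact: smooth_on_det.
    by move=> x /Fu; rewrite unitmxE unitfE.
  apply: smooth_onM => //; first exact: smooth_on_cst.
  apply: smooth_on_det => i j.
  by apply: smooth_on_ext oU _ (sF (lift l i) (lift k j)) => x _; rewrite !mxE.
by apply: smooth_on_ext oU _ S => x /Fu Fx; rewrite /invmx Fx !mxE.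
Qed.

End SmoothInverse.

(** * The Levi-Civita connection in a chart *)

Section LocalLeviCivita.
Context {R : realType} {n : nat}.
Variables (U : set 'rV[R]_n) (g : 'rV[R]_n -> 'M[R]_n).
Hypotheses (oU : open U) (sg : smooth_mx U g).
Hypothesis gS : forall x, U x -> (g x)^T = g x.
Hypothesis gpos : forall x, U x -> forall X, X != 0 -> 0 < inner (g x) X X.
Implicit Types (x X Y Z W : 'rV[R]_n).

(** The connection form evaluated on [X]. It acts on row vectors from the right: [Y *m gamma X x] is
    the covariant derivative along [X] of the field with constant components [Y]. *)
Definition gamma X x : 'M[R]_n :=
  \matrix_(j, k) \sum_i X 0 i * christoffel g k i j x.

(** The curvature form on the commuting constant fields [X] and [Y]. Right actions compose in
    reverse order, which is why [gamma Y x *m gamma X x] carries the plus sign. *)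
Definition Omega X Y x : 'M[R]_n :=
  Dmx X (gamma Y) x - Dmx Y (gamma X) x
  + gamma Y x *m gamma X x - gamma X x *m gamma Y x.

Lemma christoffel_formE x X Y : christoffel_form g x X Y = Y *m gamma X x.
Proof.
apply/rowP => k; rewrite !mxE exchange_big; apply: eq_bigr => j _.
rewrite mxE mulr_sumr; apply: eq_bigr => i _; ring.
Qed.

Lemma gamma0 x : gamma 0 x = 0.
Proof. by apply/matrixP => j k; rewrite !mxE big1// => i _; rewrite mxE mul0r. Qed.

Let gunit x : U x -> g x \in unitmx.
Proof. by move=> Ux; apply: inner_pos_unitmx; exact: gpos. Qed.

Let gS_near x : U x -> \forall y \near x, (g y)^T = g y.
Proof.
move=> Ux; near=> y; apply: gS; near: y; exact: open_nbhs_nbhs.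
Unshelve. all: by end_near. Qed.

Lemma smooth_christoffel k i j : smooth_on U (christoffel g k i j).
Proof.
apply: smooth_onM => //; first exact: smooth_on_cst.
apply: smooth_on_sum => // l; apply: smooth_onM => //.
  by apply: (smooth_mx_invmx oU sg) => x Ux; exact: gunit.
have sp a b c : smooth_on U (pderiv a (fun y => g y b c)).
  by apply: smooth_on_pderiv; exact: sg.
by apply: smooth_onD => //; [exact: smooth_onD|exact: smooth_onN].
Qed.

Lemma smooth_gamma X : smooth_mx U (gamma X).
Proof.
move=> j k.
have S : smooth_on U (fun x => \sum_i X 0 i * christoffel g k i j x).
  apply: smooth_on_sum => // i; apply: smooth_onM => //.
    exact: smooth_on_cst.
  exact: smooth_christoffel.
by apply: smooth_on_ext oU _ S => x _; rewrite mxE.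
Qed.

Lemma gamma_torsion_free x X Y : U x -> Y *m gamma X x = X *m gamma Y x.
Proof.
move=> Ux; apply/rowP => k; rewrite !mxE.
under eq_bigr do rewrite mxE mulr_sumr.
under [RHS]eq_bigr do rewrite mxE mulr_sumr.
rewrite exchange_big; apply: eq_bigr => i _; apply: eq_bigr => j _.
rewrite (christoffel_torsion_free _ _ _ (gS_near Ux)); ring.
Qed.

Lemma gamma_metric x X : U x ->
  Dmx X g x = gamma X x *m g x + g x *m (gamma X x)^T.
Proof.
move=> Ux; apply/matrixP => i j; rewrite !mxE.
rewrite derive_pderiv; last exact: smooth_on_differentiable (sg i j) Ux.
under eq_bigr do rewrite (christoffel_metric _ _ _ (gS_near Ux) (gunit Ux)) mulrDr
  !mulr_sumr.
rewrite big_split /=; congr (_ + _); rewrite exchange_big /=; apply: eq_bigr => l _;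
  rewrite !mxE ?mulr_suml ?mulr_sumr; apply: eq_bigr => k _; ring.
Qed.

Lemma Dmx_gammaE X Y Z x : U x ->
  Dmx X (fun y => Z *m gamma Y y) x = Z *m Dmx X (gamma Y) x.
Proof. by move=> Ux; apply: (DmxMl oU) => //; exact: smooth_gamma. Qed.

Lemma derive_gamma_entry X Y x i j : U x ->
  'D_X (fun y => gamma Y y i j) x
  = \sum_k \sum_l X 0 l * (Y 0 k * pderiv l (christoffel g j k i) x).
Proof.
move=> Ux.
have sc k : smooth_on U (fun y => Y 0 k * christoffel g j k i y).
  apply: smooth_onM => //; first exact: smooth_on_cst.
  exact: smooth_christoffel.
rewrite (@derive_ext_on _ _ U _
  (\sum_k (fun y => Y 0 k * christoffel g j k i y)) _ oU _ x Ux);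
  last by move=> y _; rewrite mxE fct_sumE.
rewrite derive_sum => [|k]; last exact: smooth_on_derivable (sc k) Ux.
apply: eq_bigr => k _.
have sk := smooth_christoffel j k i.
rewrite derive_pderiv; last exact: smooth_on_differentiable (sc k) Ux.
apply: eq_bigr => l _; congr (_ * _).
rewrite pderivM; last 2 first.
- exact: differentiable_cst.
- exact: smooth_on_differentiable sk Ux.
by rewrite /pderiv derive_cst mul0r addr0.
Qed.

Lemma curvatureE x X Y Z : U x -> curvature g x X Y Z = Z *m Omega X Y x.
Proof.
move=> Ux; apply/rowP => l; rewrite !mxE.
under eq_bigr do under eq_bigr do under eq_bigr do rewrite /riemann.
(* The intermediate form factors out [Z 0 k] and contracts each Christoffel symbol with [X] or [Y]
   separately, as in the [(k, l)] entry of [Omega]. *)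
transitivity (\sum_k Z 0 k * (\sum_i \sum_j
   X 0 i * (Y 0 j * pderiv i (christoffel g l j k) x)
   - \sum_j \sum_i Y 0 j * (X 0 i * pderiv j (christoffel g l i k) x)
   + \sum_m (\sum_j Y 0 j * christoffel g m j k x)
            * (\sum_i X 0 i * christoffel g l i m x)
   - \sum_m (\sum_i X 0 i * christoffel g m i k x)
            * (\sum_j Y 0 j * christoffel g l j m x))).
  transitivity (\sum_k \sum_i \sum_j Z 0 k *
     (X 0 i * (Y 0 j * pderiv i (christoffel g l j k) x)
    - Y 0 j * (X 0 i * pderiv j (christoffel g l i k) x)
    + \sum_m Y 0 j * christoffel g m j k x * (X 0 i * christoffel g l i m x)
    - \sum_m X 0 i * christoffel g m i k x * (Y 0 j * christoffel g l j m x))).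
    rewrite [RHS]exchange_big; apply: eq_bigr => i _.
    rewrite [RHS]exchange_big; apply: eq_bigr => j _.
    apply: eq_bigr => k _.
    rewrite sumrB.
    have EE (a b c d s t : R) : (a - b + (s - t)) * c * d * Z 0 k
        = Z 0 k * (c * (d * a) - d * (c * b) + c * d * s - c * d * t) by ring.
    rewrite EE.
    by congr (_ * (_ + _ - _)); rewrite mulr_sumr; apply: eq_bigr => m _; ring.
  apply: eq_bigr => k _.
  under eq_bigr do rewrite -mulr_sumr.
  rewrite -mulr_sumr; congr (_ * _).
  rewrite [X in _ = _ - X + _ - _]exchange_big /=.
  have EM (a b : 'I_n -> 'I_n -> R) : \sum_m (\sum_j a j m) * (\sum_i b i m) =
      \sum_i \sum_j \sum_m a j m * b i m.
    rewrite [RHS]exchange_big /=.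
    rewrite [RHS](eq_bigr (fun j => \sum_m \sum_i a j m * b i m));
      last by move=> j _; rewrite exchange_big.
    rewrite [RHS]exchange_big /=; apply: eq_bigr => m _.
    rewrite mulr_suml; apply: eq_bigr => j _.
    by rewrite mulr_sumr.
  rewrite EM [X in _ = _ - X]EM [X in _ = _ - X]exchange_big /=.
  by rewrite -sumrB -big_split -sumrB /=; apply: eq_bigr => i _;
    rewrite -sumrB -big_split -sumrB.
apply: eq_bigr => k _; congr (_ * _).
have -> : Omega X Y x k l = 'D_X (fun y => gamma Y y k l) x
    - 'D_Y (fun y => gamma X y k l) x
    + \sum_m gamma Y x k m * gamma X x m l - \sum_m gamma X x k m * gamma Y x m l.
  by rewrite /Omega !mxE.
rewrite !derive_gamma_entry//.
have EG A B : \sum_m gamma A x k m * gamma B x m l = \sum_m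
    (\sum_j A 0 j * christoffel g m j k x) * (\sum_i B 0 i * christoffel g l i m x).
  by apply: eq_bigr => m _; rewrite [gamma A x k m]mxE [gamma B x m l]mxE.
rewrite !EG [X in X - _ + _ - _ = _]exchange_big /=.
by rewrite [X in _ - X + _ - _ = _]exchange_big.
Qed.

Lemma Omega_antisym X Y x : Omega Y X x = - Omega X Y x.
Proof.
rewrite /Omega !opprD !opprK -!addrA addrCA; do 2 congr (_ + _).
by rewrite addrC.
Qed.

(** Second derivatives of [g] commute. Expanding both orders with [gamma_metric], the mixed products
    cancel and what remains is the skew-symmetry of the curvature form with respect to [g]. *)
Lemma Omega_metric X Y x : U x ->
  Omega X Y x *m g x + g x *m (Omega X Y x)^T = 0.
Proof.
move=> Ux.
have E A B : Dmx A (Dmx B g) x =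
    Dmx A (gamma B) x *m g x
    + gamma B x *m (gamma A x *m g x + g x *m (gamma A x)^T)
    + ((gamma A x *m g x + g x *m (gamma A x)^T) *m (gamma B x)^T
       + g x *m (Dmx A (gamma B) x)^T).
  have sB := smooth_gamma B; have sT := smooth_mxT oU sB.
  rewrite (@Dmx_ext _ _ _ oU _ _ _ _
    (fun x => gamma B x *m g x + g x *m (gamma B x)^T));
    [|by move=> y Uy; exact: gamma_metric|by []].
  rewrite (DmxD oU)//; [|exact: smooth_mxM|exact: smooth_mxM].
  by rewrite !(DmxM oU)// DmxT !gamma_metric.
have := Dmx_swap oU X Y sg Ux; rewrite !E => /eqP; rewrite -subr_eq0 => /eqP S.
move: S; rewrite /Omega.
move: (Dmx X (gamma Y) x) (Dmx Y (gamma X) x) (gamma X x) (gamma Y x) (g x).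
move=> A B P Q G <-.
have TD (K L : 'M[R]_n) : (K + L)^T = K^T + L^T by exact: linearD.
have TN (K : 'M[R]_n) : (- K)^T = - K^T by exact: linearN.
rewrite !TD !TN !mulmxDr !mulmxDl !mulmxN !mulNmx !trmx_mul !mulmxA.
(* Once the matrix monomials are opaque, the identity is linear in them and [ring] settles it
   entrywise. *)
move: (A *m G) (B *m G) (G *m A^T) (G *m B^T) (P *m Q *m G) (Q *m P *m G).
move: (P *m G *m Q^T) (Q *m G *m P^T) (G *m P^T *m Q^T) (G *m Q^T *m P^T) => *.
by apply/matrixP => i j; rewrite !mxE; ring.
Qed.

(** Torsion-freeness, and its derivative, exchange the outer vector with the argument of an adjacent
    [gamma]; after that the cyclic sum cancels in pairs. *)
Lemma Omega_bianchi X Y Z x : U x ->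
  Z *m Omega X Y x + X *m Omega Y Z x + Y *m Omega Z X x = 0.
Proof.
move=> Ux.
have D A B C : C *m Dmx A (gamma B) x = B *m Dmx A (gamma C) x.
  rewrite -!Dmx_gammaE//; apply: (Dmx_ext oU) => // y Uy.
  exact: gamma_torsion_free.
have T A B C : C *m (gamma A x *m gamma B x) = A *m (gamma C x *m gamma B x).
  by rewrite !mulmxA (gamma_torsion_free A C).
rewrite /Omega !mulmxDr !mulmxN (D X Y Z) (D Y X Z) (D Z X Y).
rewrite (T Y X Z) (T X Y Z) (T X Z Y).
move: (Y *m Dmx X _ x) (X *m Dmx Y _ x) (X *m Dmx Z _ x) => *.
move: (Y *m (_ *m _)) (X *m (gamma Z x *m _)) (X *m (gamma Y x *m _)) => *.
by apply/matrixP => i j; rewrite !mxE; ring.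
Qed.

Lemma derive_metric_gamma X Y Z x : U x ->
  'D_X (fun y => inner (g y) Y Z) x
  = inner (g x) (Y *m gamma X x) Z + inner (g x) Y (Z *m gamma X x).
Proof.
move=> Ux.
rewrite (derive_inner oU (phi := fun=> Y) (psi := fun=> Z))//;
  try exact: smooth_mx_cst.
by rewrite !Dmx_cst inner0l inner0r !addr0 gamma_metric// inner_mxD
  -inner_mulmxl -inner_mulmxr.
Qed.

(** Koszul's formula for fields with constant components, whose brackets vanish. It gives access to
    the connection of the metric on [TM] without inverting that metric. *)
Lemma gamma_koszul X Y Z x : U x ->
  2 * inner (g x) (Y *m gamma X x) Z =
  'D_X (fun y => inner (g y) Y Z) x + 'D_Y (fun y => inner (g y) X Z) x
  - 'D_Z (fun y => inner (g y) X Y) x.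
Proof.
move=> Ux; rewrite !derive_metric_gamma//.
rewrite (gamma_torsion_free Y X Ux) (gamma_torsion_free Z X Ux).
rewrite (gamma_torsion_free Z Y Ux).
rewrite (inner_sym Y (Z *m _) (gS Ux)); ring.
Qed.

(** Differentiating the Koszul expressions of [inner (g y) (Y *m gamma Y y) X] along [X] and of
    [inner (g y) (Y *m gamma X y) X] along [Y] and subtracting produces [Omega]. Only second
    derivatives of the metric and products of [gamma] terms remain, which can be compared between
    [M] and [TM]. *)
Lemma sectional_numerator X Y x : U x ->
  inner (g x) (Y *m Omega X Y x) X =
  'D_X ('D_Y (fun y => inner (g y) X Y)) x
  - 2^-1 * 'D_X ('D_X (fun y => inner (g y) Y Y)) x
  - 2^-1 * 'D_Y ('D_Y (fun y => inner (g y) X X)) x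
  + inner (g x) (Y *m gamma X x) (Y *m gamma X x)
  - inner (g x) (X *m gamma X x) (Y *m gamma Y x).
Proof.
move=> Ux.
have sc A B : smooth_mx U (fun y => A *m gamma B y).
  by apply: (smooth_mxM oU); [exact: smooth_mx_cst|exact: smooth_gamma].
have sk (A : 'rV[R]_n) := smooth_mx_cst U A.
have si A B : smooth_on U (fun y => inner (g y) A B).
  exact: (smooth_on_inner oU sg (sk A) (sk B)).
have sdi A B C : smooth_on U ('D_C (fun y => inner (g y) A B)).
  exact: smooth_on_derive.
have two0 : (2 : R) != 0 by rewrite pnatr_eq0.
have D A B C : 'D_A (fun y => inner (g y) (C *m gamma B y) X) x
    = inner (g x) (C *m gamma B x *m gamma A x) X
      + inner (g x) (C *m gamma B x) (X *m gamma A x)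
      + inner (g x) (C *m Dmx A (gamma B) x) X.
  rewrite (derive_inner oU (psi := fun=> X))// Dmx_cst inner0r addr0 Dmx_gammaE//.
  by rewrite gamma_metric// inner_mxD -inner_mulmxl -inner_mulmxr.
have DZ A f : smooth_on U f -> 2^-1 * 'D_A f x = 'D_A (fun y => 2^-1 * f y) x.
  move=> sf; rewrite -[RHS]/('D_A (2^-1 *: f) x) deriveZ//.
  exact: smooth_on_derivable sf Ux.
have sZ f : smooth_on U f -> smooth_on U (fun y => 2^-1 * f y).
  by apply: smooth_onM => //; exact: smooth_on_cst.
have DB A f h : smooth_on U f -> smooth_on U h ->
    'D_A f x - 'D_A h x = 'D_A (fun y => f y - h y) x.
  move=> sf sh; rewrite -[RHS]/('D_A (f - h) x) deriveB//.
    exact: smooth_on_derivable sf Ux.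
  exact: smooth_on_derivable sh Ux.
(* Koszul: twice this inner product is twice the derivative of [inner (g y) X Y] along [Y] minus
   that of [inner (g y) Y Y] along [X]. *)
have EY : 'D_X (fun y => inner (g y) (Y *m gamma Y y) X) x
    = 'D_X ('D_Y (fun y => inner (g y) X Y)) x
      - 2^-1 * 'D_X ('D_X (fun y => inner (g y) Y Y)) x.
  rewrite DZ// DB//; last exact: sZ.
  apply: (derive_ext_on _ oU _ Ux) => y Uy.
  apply: (mulfI two0); rewrite gamma_koszul//.
  rewrite (@derive_ext_on _ _ U (fun y => inner (g y) Y X)
    (fun y => inner (g y) X Y) _ oU)//;
    last by move=> w Uw; apply: inner_sym; exact: gS.
  by rewrite /GRing.scale /=; field.
(* Here two of the three Koszul terms cancel. *)
have EX : 'D_Y (fun y => inner (g y) (Y *m gamma X y) X) x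
    = 2^-1 * 'D_Y ('D_Y (fun y => inner (g y) X X)) x.
  rewrite DZ//.
  apply: (derive_ext_on _ oU _ Ux) => y Uy.
  apply: (mulfI two0); rewrite gamma_koszul//.
  rewrite (@derive_ext_on _ _ U (fun y => inner (g y) Y X)
    (fun y => inner (g y) X Y) _ oU)//;
    last by move=> w Uw; apply: inner_sym; exact: gS.
  by rewrite /GRing.scale /=; field.
rewrite -EY; move: EX; rewrite !D (gamma_torsion_free Y X Ux) => <-.
rewrite /Omega !mulmxDr !mulmxN !innerDl !innerNl !mulmxA.
rewrite (inner_sym (Y *m gamma Y x) _ (gS Ux)).
by do 6 move: (inner _ _ _) => ?; ring.
Qed.

End LocalLeviCivita.

(** * Symmetries of the curvature tensor *)

Section AlgebraicCurvature.
Context {R : realFieldType} {V : zmodType}.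
Variable T : V -> V -> V -> V -> R.
Hypothesis T1 : forall X X' Y Z W, T (X + X') Y Z W = T X Y Z W + T X' Y Z W.
Hypothesis T3 : forall X Y Z Z' W, T X Y (Z + Z') W = T X Y Z W + T X Y Z' W.
Hypothesis T12 : forall X Y Z W, T Y X Z W = - T X Y Z W.
Hypothesis T34 : forall X Y Z W, T X Y W Z = - T X Y Z W.
Hypothesis bianchi : forall X Y Z W, T X Y Z W + T Y Z X W + T Z X Y W = 0.
Hypothesis sec0 : forall X Y, T X Y Y X = 0.

(** Polarizing [sec0] makes [T] change sign also when its first and last arguments are exchanged.
    Hence [T] is invariant under cyclic permutation of the first three arguments, and the Bianchi
    identity reads [3 T = 0]. *)
Lemma algebraic_curvature_eq0 X Y Z W : T X Y Z W = 0.
Proof.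
have T2 A B B' C D : T A (B + B') C D = T A B C D + T A B' C D.
  by rewrite T12 T1 opprD -!T12.
have T4 A B C D D' : T A B C (D + D') = T A B C D + T A B C D'.
  by rewrite T34 T3 opprD -!T34.
(* Pair symmetry is the classical combination of the four Bianchi identities on [A], [B], [C], [D],
   with terms matched by the antisymmetries. *)
have pair A B C D : T A B C D = T C D A B.
  have := bianchi A B C D; have := bianchi B C D A.
  have := bianchi C D A B; have := bianchi D A B C.
  have := T34 B C A D; have := T34 C D A B; have := T34 A B C D.
  have := T34 D A B C; have := T12 B D C A; have := T34 B D A C.
  have := T12 C A D B; have := T34 C A B D => *.
  lra.
have T23 A B C : T A B C A = 0.
  have := sec0 A (B + C); rewrite T2 !T3 !sec0.
  by rewrite (pair A C B A) (T12 A B) (T34 A B C A) => ?; lra.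
have T14 A B C D : T D B C A = - T A B C D.
  by have := T23 (A + D) B C; rewrite T1 !T4 !T23 => ?; lra.
have cyc A B C D : T B C A D = T A B C D.
  by rewrite T12 T14 T34 T14 !opprK.
by have := bianchi X Y Z W; have := cyc Y Z X W; have := cyc X Y Z W => *; lra.
Qed.

End AlgebraicCurvature.

(** * Symmetries of the curvature of a metric, and vanishing criteria *)

Section CurvatureTensor.
Context {R : realType} {n : nat}.
Variables (U : set 'rV[R]_n) (g : 'rV[R]_n -> 'M[R]_n).
Hypotheses (oU : open U) (sg : smooth_mx U g).
Hypothesis gS : forall x, U x -> (g x)^T = g x.
Hypothesis gpos : forall x, U x -> forall X, X != 0 -> 0 < inner (g x) X X.
Implicit Types (x X Y Z W : 'rV[R]_n).

Lemma curvatureDl x X X' Y Z :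
  curvature g x (X + X') Y Z = curvature g x X Y Z + curvature g x X' Y Z.
Proof.
apply/rowP => l; rewrite !mxE -big_split; apply: eq_bigr => i _ /=.
rewrite -big_split; apply: eq_bigr => j _ /=.
rewrite -big_split; apply: eq_bigr => k _ /=; rewrite !mxE; ring.
Qed.

Lemma curvatureDr x X Y Z Z' :
  curvature g x X Y (Z + Z') = curvature g x X Y Z + curvature g x X Y Z'.
Proof.
apply/rowP => l; rewrite !mxE -big_split; apply: eq_bigr => i _ /=.
rewrite -big_split; apply: eq_bigr => j _ /=.
rewrite -big_split; apply: eq_bigr => k _ /=; rewrite !mxE; ring.
Qed.

Lemma curvatureZl x (c : R) X Y Z :
  curvature g x (c *: X) Y Z = c *: curvature g x X Y Z.
Proof.
apply/rowP => l; rewrite !mxE mulr_sumr; apply: eq_bigr => i _ /=.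
rewrite mulr_sumr; apply: eq_bigr => j _ /=.
rewrite mulr_sumr; apply: eq_bigr => k _ /=; rewrite !mxE; ring.
Qed.

Lemma curvatureZr x (c : R) X Y Z :
  curvature g x X Y (c *: Z) = c *: curvature g x X Y Z.
Proof.
apply/rowP => l; rewrite !mxE mulr_sumr; apply: eq_bigr => i _ /=.
rewrite mulr_sumr; apply: eq_bigr => j _ /=.
rewrite mulr_sumr; apply: eq_bigr => k _ /=; rewrite !mxE; ring.
Qed.

Lemma curvature_antisym x X Y Z : U x ->
  curvature g x Y X Z = - curvature g x X Y Z.
Proof.
by move=> Ux; rewrite !(curvatureE oU sg gpos)// Omega_antisym mulmxN.
Qed.

Lemma curvature_skew x X Y Z W : U x ->
  inner (g x) (curvature g x X Y W) Z = - inner (g x) (curvature g x X Y Z) W.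
Proof.
move=> Ux; rewrite !(curvatureE oU sg gpos)//.
rewrite (inner_sym _ Z (gS Ux)) inner_mulmxr [in RHS]inner_mulmxl.
have /eqP := Omega_metric oU sg gS gpos X Y Ux.
rewrite addr_eq0 => /eqP ->.
by rewrite /inner mulmxN mulNmx [in RHS]mxE opprK.
Qed.

Lemma curvature_bianchi x X Y Z : U x ->
  curvature g x X Y Z + curvature g x Y Z X + curvature g x Z X Y = 0.
Proof.
move=> Ux; rewrite !(curvatureE oU sg gpos)//.
exact: (Omega_bianchi oU sg gS gpos).
Qed.

Lemma row_free_orthogonal x X Y : U x -> X != 0 -> Y != 0 ->
  inner (g x) X Y = 0 -> row_free (col_mx X Y).
Proof.
move=> Ux X0 Y0 XY; rewrite -kermx_eq0; apply/rowV0P => v /sub_kermxP.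
rewrite -[v]hsubmxK mul_row_col (mx11_scalar (lsubmx v)) (mx11_scalar (rsubmx v)).
rewrite !mul_scalar_mx; set a := lsubmx v 0 0; set b := rsubmx v 0 0 => E.
have EX : inner (g x) (a *: X + b *: Y) X = 0 by rewrite E inner0l.
have EY : inner (g x) (a *: X + b *: Y) Y = 0 by rewrite E inner0l.
move: EX EY; rewrite !innerDl !innerZl (inner_sym Y X (gS Ux)) XY !mulr0.
rewrite addr0 add0r.
have gX := gpos Ux X0; have gY := gpos Ux Y0.
move=> /eqP; rewrite mulf_eq0 (gt_eqF gX) orbF => /eqP ->.
move=> /eqP; rewrite mulf_eq0 (gt_eqF gY) orbF => /eqP ->.
by rewrite !(raddf0 (@scalar_mx R 1)) row_mx0.
Qed.

Lemma curvature_diag x X Z : U x -> curvature g x X X Z = 0.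
Proof.
move=> Ux; have /eqP := curvature_antisym X X Z Ux.
by rewrite -addr_eq0 -mulr2n -scaler_nat scaler_eq0 pnatr_eq0 => /eqP.
Qed.

(** Gram-Schmidt: removing from [Y] its component along [X] changes the curvature operator by a
    multiple of the one on the pair [X], [X], which is zero. *)
Lemma curvature_orthogonalize x X Y : U x -> X != 0 -> exists c : R,
  inner (g x) X (Y + c *: X) = 0 /\
  forall Z, curvature g x X Y Z = curvature g x X (Y + c *: X) Z.
Proof.
move=> Ux X0; pose c := inner (g x) X Y / inner (g x) X X.
have gX := gpos Ux X0; exists (- c); split=> [|Z].
  by rewrite innerDr innerZr /c mulNr divfK ?subrr// gt_eqF.
rewrite -[RHS]opprK -curvature_antisym// curvatureDl curvatureZl curvature_diag//.
by rewrite scaler0 addr0 -curvature_antisym.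
Qed.

Lemma curvature_eq0_orthogonal x Z : U x ->
  (forall X Y, X != 0 -> Y != 0 -> inner (g x) X Y = 0 ->
     curvature g x X Y Z = 0) ->
  forall X Y, curvature g x X Y Z = 0.
Proof.
move=> Ux H X Y.
have c0l A : curvature g x 0 A Z = 0.
  by rewrite -[0 in LHS](scale0r 0) curvatureZl scale0r.
have [->//|X0] := eqVneq X 0.
have [c [XY' ->]] := curvature_orthogonalize Y Ux X0.
have [->|Y0] := eqVneq (Y + c *: X) 0; last exact: H.
by rewrite curvature_antisym// c0l oppr0.
Qed.

(** Nonzero orthogonal pairs span planes, so the hypothesis can be read off from sectional
    curvatures. Orthogonalization extends it to all pairs, and polarization to the whole tensor. *)
Lemma curvature_eq0_sectional x : U x ->
  (forall X Y, X != 0 -> Y != 0 -> inner (g x) X Y = 0 ->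
     inner (g x) (curvature g x X Y Y) X = 0) ->
  forall X Y Z, curvature g x X Y Z = 0.
Proof.
move=> Ux H.
have c0l A Z : curvature g x 0 A Z = 0.
  by rewrite -[0 in LHS](scale0r 0) curvatureZl scale0r.
have H' X Y : inner (g x) (curvature g x X Y Y) X = 0.
  have [->|X0] := eqVneq X 0; first by rewrite inner0r.
  have [c [XY' E]] := curvature_orthogonalize Y Ux X0.
  (* By skewness this term vanishes, so the second occurrence of [Y] may be orthogonalized as
     well. *)
  have XX : inner (g x) (curvature g x X Y X) X = 0.
    by have := curvature_skew X Y X X Ux => ?; lra.
  have -> : inner (g x) (curvature g x X Y Y) X =
      inner (g x) (curvature g x X (Y + c *: X) (Y + c *: X)) X.
    by rewrite -E curvatureDr curvatureZr innerDl innerZl XX mulr0 addr0.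
  have [->|Y0] := eqVneq (Y + c *: X) 0; last exact: H.
  by rewrite curvature_antisym// c0l oppr0 inner0l.
(* A nonzero value of the tensor would have positive square norm, but that norm is the 4-linear form
   with the value itself as last argument. *)
move=> X Y Z; apply/eqP; apply: contraT => /(gpos Ux).
pose T X Y Z W := inner (g x) (curvature g x X Y Z) W.
rewrite -[inner _ _ _]/(T X Y Z _) (algebraic_curvature_eq0 (T := T)) /T.
- by rewrite ltxx.
- by move=> *; rewrite curvatureDl innerDl.
- by move=> *; rewrite curvatureDr innerDl.
- by move=> *; rewrite curvature_antisym// innerNl.
- by move=> *; rewrite curvature_skew.
- by move=> *; rewrite -!innerDl curvature_bianchi// inner0l.
- by [].
Qed.

End CurvatureTensor.

(** * Metrics on the tangent bundle of a chart *)

Section SubmatrixDerivatives.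
Context {R : realType} {n m : nat}.
Variables (U : set 'rV[R]_n) (oU : open U).
Local Notation V := (lsubmx @^-1` U : set 'rV[R]_(n + m)).

Lemma derive_lsubmx (f : 'rV[R]_n -> R) (v z : 'rV[R]_(n + m)) :
  'D_v (fun w => f (lsubmx w)) z = 'D_(lsubmx v) f (lsubmx z).
Proof.
by apply: (derive_comp_affine (L := @lsubmx R 1 n m)) => t; rewrite linearP.
Qed.

Lemma derive2_lsubmx (f : 'rV[R]_n -> R) (u v z : 'rV[R]_(n + m)) :
  'D_u ('D_v (fun w => f (lsubmx w))) z
  = 'D_(lsubmx u) ('D_(lsubmx v) f) (lsubmx z).
Proof.
rewrite -derive_lsubmx; congr ('D_u _ z).
by apply/funext => w; rewrite derive_lsubmx.
Qed.

Lemma derive_row_mx0 (f : 'rV[R]_(n + m) -> R) (v z : 'rV[R]_n) :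
  'D_(row_mx v 0) f (row_mx z 0) = 'D_v (fun w => f (row_mx w 0)) z.
Proof.
pose L (w : 'rV[R]_n) := row_mx w (0 : 'rV[R]_m).
apply/esym; apply: (derive_comp_affine (L := L)) => t; rewrite /L.
by rewrite scale_row_mx add_row_mx scaler0 addr0.
Qed.

Lemma smooth_mx_lsubmx p q (F : 'rV[R]_n -> 'M[R]_(p, q)) :
  smooth_mx U F -> smooth_mx V (fun z => F (lsubmx z)).
Proof. by move=> sF i j; exact: (smooth_on_lsubmx _ oU (sF i j)). Qed.

Lemma Dmx_lsubmx p q (F : 'rV[R]_n -> 'M[R]_(p, q)) (v z : 'rV[R]_(n + m)) :
  Dmx v (fun w => F (lsubmx w)) z = Dmx (lsubmx v) F (lsubmx z).
Proof.
apply/matrixP => i j; rewrite !mxE.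
exact: (derive_lsubmx (fun w => F w i j)).
Qed.

Lemma smooth_mx_rsubmx (W : set 'rV[R]_(n + m)) : open W ->
  smooth_mx W (fun z => rsubmx z).
Proof.
move=> oW i j.
apply: smooth_on_ext oW _ (smooth_on_coord (rshift n j) oW) => z _.
by rewrite mxE ord1.
Qed.

Lemma Dmx_rsubmx (v z : 'rV[R]_(n + m)) : Dmx v rsubmx z = rsubmx v.
Proof.
apply/rowP => j; rewrite !mxE.
pose k := rshift n j.
have L (t : R) : (t *: v + z) 0 k = t *: v 0 k + z 0 k by rewrite !mxE.
have := derive_comp_affine (W := R) (L := fun y : 'rV[R]_(n + m) => y 0 k) id L.
rewrite derive_id => <-.
by congr ('D_v _ z); apply/funext => w; rewrite mxE.
Qed.

End SubmatrixDerivatives.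

Section SmoothSums.
Context {R : realType} {N : nat}.
Variables (U : set 'rV[R]_N) (oU : open U).

Lemma derive_onD f h (v z : 'rV[R]_N) : smooth_on U f -> smooth_on U h -> U z ->
  'D_v (fun w => f w + h w) z = 'D_v f z + 'D_v h z.
Proof.
move=> sf sh Uz; rewrite -deriveD//.
  exact: smooth_on_derivable sf Uz.
exact: smooth_on_derivable sh Uz.
Qed.

Lemma derive2_onD f h (u v z : 'rV[R]_N) : smooth_on U f -> smooth_on U h -> U z ->
  'D_u ('D_v (fun w => f w + h w)) z = 'D_u ('D_v f) z + 'D_u ('D_v h) z.
Proof.
move=> sf sh Uz.
have sf' := smooth_on_derive v oU sf; have sh' := smooth_on_derive v oU sh.
rewrite -derive_onD//; apply: (derive_ext_on _ oU _ Uz) => w Uw.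
exact: derive_onD.
Qed.

Lemma derive2_ext (f h : 'rV[R]_N -> R) (u v z : 'rV[R]_N) :
  (forall w, U w -> f w = h w) -> U z ->
  'D_u ('D_v f) z = 'D_u ('D_v h) z.
Proof.
move=> fh Uz; apply: (derive_ext_on _ oU _ Uz) => w Uw.
exact: (derive_ext_on _ oU fh Uw).
Qed.

Variables (n : nat) (Q : 'rV[R]_N -> 'M[R]_n) (phi psi : 'rV[R]_N -> 'rV[R]_n).
Hypotheses (sQ : smooth_mx U Q) (sphi : smooth_mx U phi) (spsi : smooth_mx U psi).

Lemma derive_inner_vanishl v z : U z -> phi z = 0 ->
  'D_v (fun w => inner (Q w) (phi w) (psi w)) z
  = inner (Q z) (Dmx v phi z) (psi z).
Proof.
by move=> Uz p0; rewrite (derive_inner oU)// p0 !inner0l add0r addr0.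
Qed.

Lemma derive_inner_vanishr v z : U z -> psi z = 0 ->
  'D_v (fun w => inner (Q w) (phi w) (psi w)) z
  = inner (Q z) (phi z) (Dmx v psi z).
Proof.
by move=> Uz p0; rewrite (derive_inner oU)// p0 !inner0r !add0r.
Qed.

End SmoothSums.

(** By the Leibniz rule, only the terms in which each vanishing factor is differentiated exactly
    once survive at [z]. In particular no derivative of [Q] is left. *)
Lemma derive2_inner_vanish (R : realType) (N n : nat) (U : set 'rV[R]_N)
    (Q : 'rV[R]_N -> 'M[R]_n) (phi psi : 'rV[R]_N -> 'rV[R]_n) u v z :
  open U -> smooth_mx U Q -> smooth_mx U phi -> smooth_mx U psi ->
  U z -> phi z = 0 -> psi z = 0 ->
  'D_u ('D_v (fun w => inner (Q w) (phi w) (psi w))) z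
  = inner (Q z) (Dmx u phi z) (Dmx v psi z)
    + inner (Q z) (Dmx v phi z) (Dmx u psi z).
Proof.
move=> oU sQ sphi spsi Uz p0 q0.
have sQ' := smooth_mx_derive oU v sQ.
have sphi' := smooth_mx_derive oU v sphi.
have spsi' := smooth_mx_derive oU v spsi.
rewrite (@derive_ext_on _ _ U _ (fun w => inner (Dmx v Q w) (phi w) (psi w)
  + inner (Q w) (Dmx v phi w) (psi w) + inner (Q w) (phi w) (Dmx v psi w)) _ oU _ z Uz);
  last by move=> w Uw; exact: (derive_inner oU).
rewrite (derive_onD (U := U)) => //; last 2 first.
- by apply: smooth_onD => //; exact: smooth_on_inner.
- exact: smooth_on_inner.
rewrite (derive_onD (U := U)) => //; last 2 first.
- exact: smooth_on_inner.
- exact: smooth_on_inner.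
rewrite (derive_inner_vanishl oU)// q0 inner0r add0r addrC.
by rewrite (derive_inner_vanishl oU)// (derive_inner_vanishr oU).
Qed.

(** * A metric on the tangent bundle of a chart, split by the connection *)

Section TangentBundleMetric.
Context {R : realType} {n : nat}.
Variables (U : set 'rV[R]_n) (g : 'rV[R]_n -> 'M[R]_n).
Hypotheses (oU : open U) (sg : smooth_mx U g).
Hypothesis gS : forall x, U x -> (g x)^T = g x.
Hypothesis gpos : forall x, U x -> forall X, X != 0 -> 0 < inner (g x) X X.

Local Notation TU := (lsubmx @^-1` U : set 'rV[R]_(n + n)).
Variable F : 'rV[R]_(n + n) -> 'M[R]_(n + n).
Hypothesis sF : smooth_mx TU F.
Hypothesis FS : forall z, TU z -> (F z)^T = F z.
Hypothesis Fpos : forall z, TU z -> forall W, W != 0 -> 0 < inner (F z) W W.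

(** The restriction of the metric to the fibre directions, whose coordinates are [row_mx 0 X]. *)
Definition vertical_metric (z : 'rV[R]_(n + n)) : 'M[R]_n := drsubmx (F z).

(** The coordinate form of [kappa], as a function of the point [z] for a fixed component vector [W],
    so that it can be differentiated in [z]. *)
Definition connection_map (W z : 'rV[R]_(n + n)) : 'rV[R]_n :=
  rsubmx W + rsubmx z *m gamma g (lsubmx W) (lsubmx z).

Hypothesis FE : forall z, TU z -> forall W W', inner (F z) W W' =
  inner (g (lsubmx z)) (lsubmx W) (lsubmx W')
  + inner (vertical_metric z) (connection_map W z) (connection_map W' z).

Implicit Types (X Y Z : 'rV[R]_n) (z V W : 'rV[R]_(n + n)).
Local Notation Q := vertical_metric.
Local Notation K := connection_map.

Let oTU : open TU.
Proof. exact: open_lsubmx_preimage. Qed.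

Lemma smooth_vertical_metric : smooth_mx TU Q.
Proof.
move=> i j; apply: smooth_on_ext oTU _ (sF (rshift n i) (rshift n j)) => z _.
by rewrite !mxE.
Qed.

Let sQ := smooth_vertical_metric.

Lemma vertical_metric_sym z : TU z -> (Q z)^T = Q z.
Proof. by move=> Uz; rewrite /Q trmx_drsub FS. Qed.

Lemma inner_vertical_metric z X Y :
  inner (F z) (row_mx 0 X) (row_mx 0 Y) = inner (Q z) X Y.
Proof.
rewrite /inner -[in LHS](submxK (F z)) tr_row_mx trmx0 mul_row_block !mul0mx !add0r.
by rewrite mul_row_col mulmx0 add0r.
Qed.

Let sgamma X : smooth_mx TU (fun z => gamma g X (lsubmx z)).
Proof. exact: (smooth_mx_lsubmx (m := n) oU (smooth_gamma oU sg gpos X)). Qed.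

Let sr : smooth_mx TU (fun z => rsubmx z : 'rV[R]_n).
Proof. exact: smooth_mx_rsubmx. Qed.

Lemma smooth_connection_map W : smooth_mx TU (K W).
Proof.
apply: (smooth_mxD oTU); first exact: smooth_mx_cst.
exact: (smooth_mxM oTU).
Qed.

Let sK := smooth_connection_map.

Lemma Dmx_connection_map V W z : TU z ->
  Dmx V (K W) z = rsubmx V *m gamma g (lsubmx W) (lsubmx z)
    + rsubmx z *m Dmx (lsubmx V) (gamma g (lsubmx W)) (lsubmx z).
Proof.
move=> Uz.
have sG := sgamma (lsubmx W).
have sM := smooth_mxM oTU sr sG.
rewrite (DmxD oTU V (smooth_mx_cst TU (rsubmx W)) sM Uz) Dmx_cst add0r.
by rewrite (DmxM oTU V sr sG Uz) Dmx_rsubmx Dmx_lsubmx.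
Qed.

Lemma derive_metric W W' V z : TU z -> 'D_V (fun w => inner (F w) W W') z =
  'D_(lsubmx V) (fun x => inner (g x) (lsubmx W) (lsubmx W')) (lsubmx z)
  + 'D_V (fun w => inner (Q w) (K W w) (K W' w)) z.
Proof.
move=> Uz.
rewrite (@derive_ext_on _ _ TU _ _ _ oTU (fun w Uw => FE Uw W W') z Uz).
have sgW := smooth_on_inner oU sg (smooth_mx_cst U (lsubmx W))
  (smooth_mx_cst U (lsubmx W')).
have sQW := smooth_on_inner oTU sQ (sK W) (sK W').
rewrite (derive_onD V (smooth_on_lsubmx n oU sgW) sQW Uz).
by rewrite (derive_lsubmx (fun x => inner (g x) (lsubmx W) (lsubmx W'))).
Qed.

Lemma derive2_metric W W' V V' z : TU z ->
  'D_V' ('D_V (fun w => inner (F w) W W')) z =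
  'D_(lsubmx V') ('D_(lsubmx V)
    (fun x => inner (g x) (lsubmx W) (lsubmx W'))) (lsubmx z)
  + 'D_V' ('D_V (fun w => inner (Q w) (K W w) (K W' w))) z.
Proof.
move=> Uz.
rewrite (@derive2_ext _ _ TU oTU _ _ _ _ _ (fun w Uw => FE Uw W W') Uz).
have sgW := smooth_on_inner oU sg (smooth_mx_cst U (lsubmx W))
  (smooth_mx_cst U (lsubmx W')).
have sQW := smooth_on_inner oTU sQ (sK W) (sK W').
rewrite (derive2_onD oTU V' V (smooth_on_lsubmx n oU sgW) sQW Uz).
by rewrite (derive2_lsubmx (fun x => inner (g x) (lsubmx W) (lsubmx W'))).
Qed.

(** * Curvature of horizontal planes *)

Section HorizontalPlanes.
Variables (z : 'rV[R]_(n + n)) (Uz : TU z).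
Local Notation x := (lsubmx z).
Local Notation y := (rsubmx z).

(** The horizontal lift of [X] at the fixed point [z]. Viewed as a field with constant components it
    is horizontal at [z], but not necessarily elsewhere. *)
Definition horizontal X : 'rV[R]_(n + n) := row_mx X (- (y *m gamma g X x)).

Local Notation P X Y := (Dmx (horizontal X) (K (horizontal Y)) z).

Lemma connection_map_horizontal X : K (horizontal X) z = 0.
Proof. by rewrite /K row_mxKr row_mxKl addrC subrr. Qed.

(** Curvature as the obstruction to integrability of the horizontal spaces. The quadratic terms of
    [Omega] come from the motion of the fibre coordinate along the lifts. *)
Lemma Dmx_horizontal_swap X Y : P X Y - P Y X = y *m Omega g X Y x.
Proof.
rewrite !Dmx_connection_map// !row_mxKr !row_mxKl /Omega !mulmxDr !mulmxN !mulNmx.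
rewrite !mulmxA.
move: (y *m gamma g X x *m gamma g Y x) (y *m gamma g Y x *m gamma g X x).
move: (y *m Dmx X _ x) (y *m Dmx Y _ x) => *.
by apply/rowP => j; rewrite !mxE; ring.
Qed.

Lemma derive_metric_horizontal X Y W :
  'D_(horizontal X) (fun w => inner (F w) (horizontal Y) W) z =
  'D_X (fun x => inner (g x) Y (lsubmx W)) x + inner (Q z) (P X Y) (K W z).
Proof.
rewrite derive_metric// !row_mxKl; congr (_ + _).
by rewrite (derive_inner_vanishl oTU)// connection_map_horizontal.
Qed.

Lemma derive_metric_horizontal2 X Y W :
  'D_W (fun w => inner (F w) (horizontal X) (horizontal Y)) z =
  'D_(lsubmx W) (fun x => inner (g x) X Y) x.
Proof.
rewrite derive_metric// !row_mxKl (derive_inner_vanishl oTU)//.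
  by rewrite connection_map_horizontal inner0r addr0.
exact: connection_map_horizontal.
Qed.

Lemma derive2_metric_horizontal A B C D :
  'D_(horizontal A) ('D_(horizontal B)
     (fun w => inner (F w) (horizontal C) (horizontal D))) z =
  'D_A ('D_B (fun x => inner (g x) C D)) x
  + (inner (Q z) (P A C) (P B D) + inner (Q z) (P B C) (P A D)).
Proof.
rewrite derive2_metric// !row_mxKl; congr (_ + _).
exact: (derive2_inner_vanish _ _ oTU sQ (sK _) (sK _) Uz
  (connection_map_horizontal C) (connection_map_horizontal D)).
Qed.

(** In Koszul's formula on [TM] the base terms reassemble into Koszul's formula for [g]. The
    derivative along [W] adds no vertical term, since both lifts have zero [kappa]-component at
    [z]. *)
Lemma inner_gamma_horizontal X Y W :
  inner (F z) (horizontal Y *m gamma F (horizontal X) z) W =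
  inner (g x) (Y *m gamma g X x) (lsubmx W)
  + 2^-1 * inner (Q z) (P X Y + P Y X) (K W z).
Proof.
have two0 : (2 : R) != 0 by rewrite pnatr_eq0.
apply: (mulfI two0); rewrite (gamma_koszul oTU sF FS Fpos)//.
rewrite !derive_metric_horizontal derive_metric_horizontal2 mulrDr.
have Kz := gamma_koszul oU sg gS gpos X Y (lsubmx W) Uz.
by rewrite Kz [2 * (_ * _)]mulrA mulfV// mul1r innerDl addrACA [RHS]addrAC.
Qed.

Lemma inner_gamma_gamma_horizontal A B C D :
  inner (F z) (horizontal A *m gamma F (horizontal B) z)
              (horizontal C *m gamma F (horizontal D) z) =
  inner (g x) (A *m gamma g B x) (C *m gamma g D x)
  + 4^-1 * inner (Q z) (P B A + P A B) (P D C + P C D).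
Proof.
(* The vector representing the functional of [inner_gamma_horizontal]: its base part is read off
   directly, and its fibre part is corrected so that [connection_map] takes the required value. *)
pose S : 'rV[R]_(n + n) := row_mx (C *m gamma g D x)
  (2^-1 *: (P D C + P C D) - y *m gamma g (C *m gamma g D x) x).
have lS : lsubmx S = C *m gamma g D x by rewrite row_mxKl.
have KS : K S z = 2^-1 *: (P D C + P C D) by rewrite /K lS row_mxKr subrK.
have SE W :
    inner (F z) (horizontal C *m gamma F (horizontal D) z) W = inner (F z) S W.
  by rewrite inner_gamma_horizontal FE// lS KS innerZl.
rewrite (inner_sym _ (horizontal C *m _))// ?FS// SE (inner_sym S)// ?FS//.
rewrite inner_gamma_horizontal lS KS innerZr mulrA.
by congr (_ + _ * _); field.
Qed.

(** O'Neill's formula: up to sign, [y *m Omega g X Y x] is the vertical part of the bracket of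
    horizontal extensions of the two lifts. *)
Lemma sectional_numerator_horizontal X Y :
  inner (F z) (horizontal Y *m Omega F (horizontal X) (horizontal Y) z)
    (horizontal X) =
  inner (g x) (Y *m Omega g X Y x) X
  - 3 / 4 * inner (Q z) (y *m Omega g X Y x) (y *m Omega g X Y x).
Proof.
(* The intermediate equations are chained with [eq_trans]: rewriting with them
   would compare iterated derivatives up to conversion. *)
have cong5 (a b c d e a' b' c' d' e' : R) :
    a = a' -> b = b' -> c = c' -> d = d' -> e = e' ->
    a - 2^-1 * b - 2^-1 * c + d - e = a' - 2^-1 * b' - 2^-1 * c' + d' - e'.
  by move=> -> -> -> -> ->.
(* Used with [a = P X X], [b = P X Y], [c = P Y X], [d = P Y Y]. The terms in [a] and [d] cancel;
   the squares of [b] and [c] get [-1 + 1/4] and their product [1 + 1/2], which is [-3/4] times the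
   square of [b - c]. *)
have alg (q : 'M[R]_n) (a b c d : 'rV[R]_n) (d1 d2 d3 g1 g2 : R) : q^T = q ->
    d1 + (inner q a d + inner q c b) - 2^-1 * (d2 + (inner q b b + inner q b b))
    - 2^-1 * (d3 + (inner q c c + inner q c c))
    + (g1 + 4^-1 * inner q (b + c) (b + c)) - (g2 + 4^-1 * inner q (a + a) (d + d))
    = d1 - 2^-1 * d2 - 2^-1 * d3 + g1 - g2 - 3 / 4 * inner q (b - c) (b - c).
  move=> qS; rewrite !(innerDl, innerDr, innerNl, innerNr) (inner_sym c b qS).
  by move: (inner _ a d) (inner _ b b) (inner _ b c) (inner _ c c) => *; field.
have Kg := sectional_numerator oU sg gS gpos X Y Uz.
rewrite Kg -Dmx_horizontal_swap.
apply: (eq_trans (sectional_numerator oTU sF FS Fpos _ _ Uz)).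
apply: (eq_trans (cong5 _ _ _ _ _ _ _ _ _ _
  (derive2_metric_horizontal X Y X Y) (derive2_metric_horizontal X X Y Y)
  (derive2_metric_horizontal Y Y X X) (inner_gamma_gamma_horizontal Y X Y X)
  (inner_gamma_gamma_horizontal X X Y Y))).
exact: (alg _ _ _ _ _ _ _ _ _ _ (vertical_metric_sym Uz)).
Qed.

Lemma metric_horizontal X Y :
  inner (F z) (horizontal X) (horizontal Y) = inner (g x) X Y.
Proof. by rewrite FE// connection_map_horizontal inner0l addr0 !row_mxKl. Qed.

End HorizontalPlanes.

(** * Mixed planes along the zero section *)

Section ZeroSection.
Variable c : R.
Hypothesis QE : forall x, U x -> vertical_metric (row_mx x 0) = c *: g x.

Local Notation zero_at x := (row_mx x (0 : 'rV[R]_n)).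
Local Notation vert w := (row_mx (0 : 'rV[R]_n) w).

Let zU x : U x -> TU (zero_at x).
Proof. by rewrite /preimage /= row_mxKl. Qed.

Lemma connection_map_zero W x : K W (zero_at x) = rsubmx W.
Proof. by rewrite /K row_mxKr mul0mx addr0. Qed.

Lemma Dmx_connection_map_zero V W x : U x ->
  Dmx V (K W) (zero_at x) = rsubmx V *m gamma g (lsubmx W) x.
Proof.
move=> Ux; rewrite (Dmx_connection_map _ _ (zU Ux)) row_mxKr row_mxKl.
by rewrite mul0mx addr0.
Qed.

Lemma metric_zero W W' x : U x -> inner (F (zero_at x)) W W' =
  inner (g x) (lsubmx W) (lsubmx W') + c * inner (g x) (rsubmx W) (rsubmx W').
Proof.
move=> Ux; rewrite (FE (zU Ux)) !connection_map_zero row_mxKl QE//.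
by rewrite inner_scale_mx.
Qed.

Let sg_inner X Y : smooth_on U (fun x => inner (g x) X Y).
Proof. exact: (smooth_on_inner oU sg (smooth_mx_cst U X) (smooth_mx_cst U Y)). Qed.

Let derive_scale (f : 'rV[R]_n -> R) (a : R) v x : smooth_on U f -> U x ->
  'D_v (fun x => a * f x) x = a * 'D_v f x.
Proof.
move=> sf Ux; rewrite -[LHS]/('D_v (a *: f) x) deriveZ//.
exact: smooth_on_derivable sf Ux.
Qed.

(** A base direction stays in the zero section, so the formula of [metric_zero] may be
    differentiated directly. *)
Lemma derive_metric_zero_l X W W' x : U x ->
  'D_(row_mx X 0) (fun z => inner (F z) W W') (zero_at x) =
  'D_X (fun x => inner (g x) (lsubmx W) (lsubmx W')) x
  + c * 'D_X (fun x => inner (g x) (rsubmx W) (rsubmx W')) x.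
Proof.
move=> Ux; rewrite derive_row_mx0.
have sc : smooth_on U (fun x => c * inner (g x) (rsubmx W) (rsubmx W')).
  exact: (smooth_onM oU (smooth_on_cst U c) (sg_inner _ _)).
rewrite -(derive_scale _ _ (sg_inner _ _) Ux) -(derive_onD _ (sg_inner _ _) sc Ux).
by apply: (derive_ext_on _ oU _ Ux) => w Uw; rewrite metric_zero.
Qed.

(** The direction [V] may leave the zero section. Since the [kappa]-component of [W] vanishes there,
    the fibre derivative of the vertical metric still drops out. *)
Lemma derive_metric_zero V W W' x : U x -> rsubmx W = 0 ->
  'D_V (fun z => inner (F z) W W') (zero_at x) =
  'D_(lsubmx V) (fun x => inner (g x) (lsubmx W) (lsubmx W')) x
  + c * inner (g x) (rsubmx V *m gamma g (lsubmx W) x) (rsubmx W').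
Proof.
move=> Ux W0; have K0 : K W (zero_at x) = 0 by rewrite connection_map_zero.
rewrite (derive_metric _ _ _ (zU Ux)) row_mxKl; congr (_ + _).
rewrite (derive_inner_vanishl oTU sQ (sK W) (sK W') V (zU Ux) K0).
by rewrite Dmx_connection_map_zero// connection_map_zero QE// inner_scale_mx.
Qed.

Lemma inner_gamma_mixed X w V x : U x ->
  inner (F (zero_at x)) (vert w *m gamma F (row_mx X 0) (zero_at x)) V =
  c * inner (g x) (w *m gamma g X x) (rsubmx V).
Proof.
move=> Ux; have two0 : (2 : R) != 0 by rewrite pnatr_eq0.
have Xr : rsubmx (row_mx X (0 : 'rV[R]_n)) = 0 by rewrite row_mxKr.
apply: (mulfI two0); rewrite (gamma_koszul oTU sF FS Fpos _ _ _ (zU Ux)).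
rewrite (derive_metric_zero_l X (vert w) V Ux).
rewrite (derive_metric_zero (vert w) V Ux Xr).
rewrite (derive_metric_zero V (vert w) Ux Xr) !row_mxKl !row_mxKr.
rewrite (derive_metric_gamma oU sg gS gpos X 0 (lsubmx V) Ux) derive0.
rewrite (derive_metric_gamma oU sg gS gpos X w (rsubmx V) Ux).
rewrite (derive_metric_gamma oU sg gS gpos (lsubmx V) X 0 Ux).
rewrite !mul0mx !inner0l !inner0r (inner_sym w _ (gS Ux)).
by move: (inner _ _ _) (inner _ _ _) => *; ring.
Qed.

(** The fibre has zero second fundamental form at the zero vector. *)
Lemma inner_gamma_vertical_horizontal w X x : U x ->
  inner (F (zero_at x)) (vert w *m gamma F (vert w) (zero_at x)) (row_mx X 0) = 0.
Proof.
move=> Ux; have two0 : (2 : R) != 0 by rewrite pnatr_eq0.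
have Xr : rsubmx (row_mx X (0 : 'rV[R]_n)) = 0 by rewrite row_mxKr.
have swap : 'D_(vert w) (fun z => inner (F z) (vert w) (row_mx X 0)) (zero_at x)
    = 'D_(vert w) (fun z => inner (F z) (row_mx X 0) (vert w)) (zero_at x).
  apply: (derive_ext_on _ oTU _ (zU Ux)) => z Uz.
  by apply: inner_sym; exact: FS.
apply: (mulfI two0); rewrite (gamma_koszul oTU sF FS Fpos _ _ _ (zU Ux)) swap.
rewrite (derive_metric_zero (vert w) (vert w) Ux Xr).
rewrite (derive_metric_zero_l X (vert w) (vert w) Ux) !row_mxKl !row_mxKr derive0.
rewrite !(derive_metric_gamma oU sg gS gpos X _ _ Ux) !mul0mx !inner0l.
rewrite (inner_sym w _ (gS Ux)).
by move: (inner _ _ _) => *; ring.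
Qed.

(** The zero section is totally geodesic: the covariant derivative computed here is tangent to
    it. *)
Lemma inner_gamma_horizontal_zero X V x : U x ->
  inner (F (zero_at x)) (row_mx X 0 *m gamma F (row_mx X 0) (zero_at x)) V =
  inner (g x) (X *m gamma g X x) (lsubmx V).
Proof.
move=> Ux; have two0 : (2 : R) != 0 by rewrite pnatr_eq0.
have Xr : rsubmx (row_mx X (0 : 'rV[R]_n)) = 0 by rewrite row_mxKr.
apply: (mulfI two0); rewrite (gamma_koszul oTU sF FS Fpos _ _ _ (zU Ux)).
rewrite !(derive_metric_zero _ _ Ux Xr) !row_mxKl !row_mxKr.
rewrite (gamma_koszul oU sg gS gpos X X (lsubmx V) Ux).
by rewrite mul0mx inner0l inner0r mulr0 !addr0.
Qed.

(** In the five terms of [sectional_numerator], [T1] cancels against half of [T2], half of [T3]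
    cancels against [N1], and [N2] pairs a vector tangent to the zero section with one having no
    horizontal part. *)
Lemma sectional_numerator_mixed X w x : U x ->
  inner (F (zero_at x)) (vert w *m Omega F (row_mx X 0) (vert w) (zero_at x))
    (row_mx X 0) = 0.
Proof.
move=> Ux; have two0 : (2 : R) != 0 by rewrite pnatr_eq0.
have Xr : rsubmx (row_mx X (0 : 'rV[R]_n)) = 0 by rewrite row_mxKr.
have Uz := zU Ux.
apply: (eq_trans (sectional_numerator oTU sF FS Fpos _ _ Uz)).
(* At every point of the zero section the inner derivative is [c / 2] times that of
   [inner (g x) w w] along [X], so only a derivative along the base remains. *)
have T1 : 'D_(row_mx X 0) ('D_(vert w) (fun z => inner (F z) (row_mx X 0) (vert w)))
    (zero_at x) = c * 2^-1 * 'D_X ('D_X (fun x => inner (g x) w w)) x.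
  rewrite derive_row_mx0.
  rewrite -(derive_scale _ _ (smooth_on_derive X oU (sg_inner w w)) Ux).
  apply: (derive_ext_on _ oU _ Ux) => v Uv.
  rewrite (derive_metric_zero _ _ Uv Xr) !row_mxKl !row_mxKr derive0 add0r.
  rewrite (derive_metric_gamma oU sg gS gpos X _ _ Uv) (inner_sym w _ (gS Uv)).
  by move: (inner _ _ _) => *; field.
have T2 : 'D_(row_mx X 0) ('D_(row_mx X 0) (fun z => inner (F z) (vert w) (vert w)))
    (zero_at x) = c * 'D_X ('D_X (fun x => inner (g x) w w)) x.
  rewrite derive_row_mx0.
  rewrite -(derive_scale _ _ (smooth_on_derive X oU (sg_inner w w)) Ux).
  apply: (derive_ext_on _ oU _ Ux) => v Uv.
  rewrite (derive_metric_zero_l _ _ _ Uv) !row_mxKl !row_mxKr.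
  by rewrite (derive_metric_gamma oU sg gS gpos X _ _ Uv) mul0mx !inner0l !add0r.
have T3 : 'D_(vert w) ('D_(vert w) (fun z => inner (F z) (row_mx X 0) (row_mx X 0)))
    (zero_at x) = 2 * c * inner (g x) (w *m gamma g X x) (w *m gamma g X x).
  rewrite (derive2_metric _ _ _ _ Uz) !row_mxKl derive0 add0r.
  have K0 : K (row_mx X 0) (zero_at x) = 0 by rewrite connection_map_zero.
  rewrite (derive2_inner_vanish _ _ oTU sQ (sK _) (sK _) Uz K0 K0).
  rewrite !Dmx_connection_map_zero// row_mxKl row_mxKr QE// inner_scale_mx.
  by move: (inner _ _ _) => *; ring.
have N1 : inner (F (zero_at x)) (vert w *m gamma F (row_mx X 0) (zero_at x))
    (vert w *m gamma F (row_mx X 0) (zero_at x))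
    = c * inner (g x) (w *m gamma g X x) (w *m gamma g X x).
  have SE V : inner (F (zero_at x)) (vert w *m gamma F (row_mx X 0) (zero_at x)) V
      = inner (F (zero_at x)) (vert (w *m gamma g X x)) V.
    by rewrite inner_gamma_mixed// metric_zero// row_mxKl row_mxKr inner0l add0r.
  by rewrite SE (inner_sym _ _ (FS Uz)) inner_gamma_mixed// row_mxKr.
have N2 : inner (F (zero_at x)) (row_mx X 0 *m gamma F (row_mx X 0) (zero_at x))
    (vert w *m gamma F (vert w) (zero_at x)) = 0.
  rewrite inner_gamma_horizontal_zero//.
  have := inner_gamma_vertical_horizontal w (X *m gamma g X x) Ux.
  rewrite (inner_sym _ _ (FS Uz)) metric_zero// row_mxKl row_mxKr inner0l mulr0.
  by rewrite addr0.
rewrite T1 T2 T3 N1 N2.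
by move: (inner _ _ _) ('D_X _ x) => *; field.
Qed.

End ZeroSection.

End TangentBundleMetric.

(** * Natural metrics *)

Lemma inner_congruence (R : realType) (m n : nat) (A : 'M[R]_n) (B : 'M[R]_(m, n))
    (X Y : 'rV[R]_m) :
  inner A (X *m B) (Y *m B) = inner (B *m A *m B^T) X Y.
Proof. by rewrite /inner trmx_mul !mulmxA. Qed.

Lemma mulmx_inner (R : realType) (m n : nat) (A : 'M[R]_n) (B : 'M[R]_(m, n)) i j :
  (B *m A *m B^T) i j = inner A (row i B) (row j B).
Proof.
by rewrite /inner -row_mul [LHS]mxE [RHS]mxE; apply: eq_bigr => k _; rewrite !mxE.
Qed.

(* Cholesky: eliminate the first row and column, then use the Schur
   complement. *)
Lemma orthonormal_basis (R : realType) (n : nat) (A : 'M[R]_n) : A^T = A ->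
  (forall X, X != 0 -> 0 < inner A X X) ->
  exists u : 'M[R]_n, u *m A *m u^T = 1%:M.
Proof.
elim: n A => [|n IH] A AS Apos; first by exists 0; apply/matrixP => -[].
change 'M[R]_(1 + n) in A.
pose a := A 0 0.
have a0 : 0 < a.
  have -> : a = inner A (row 0 1%:M) (row 0 1%:M).
    by rewrite -mulmx_inner trmx1 mulmx1 mul1mx.
  apply: Apos; apply/eqP => /matrixP/(_ 0 0)/eqP.
  by rewrite !mxE !eqxx oner_eq0.
have ulA : ulsubmx A = a%:M.
  by rewrite [LHS]mx11_scalar !mxE; congr (A _ _)%:M; apply: val_inj.
pose b := ursubmx A.
have dlA : dlsubmx A = b^T by rewrite /b trmx_ursub AS.
pose S := drsubmx A - a^-1 *: (b^T *m b).
pose L : 'M[R]_(1 + n) := block_mx 1%:M 0 (- a^-1 *: b^T) 1%:M.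
have LA : L *m A *m L^T = block_mx a%:M 0 0 S.
  rewrite -[in LHS](submxK A) ulA dlA -/b tr_block_mx !trmx1 trmx0 linearZ /= trmxK.
  rewrite !mulmx_block !(mul1mx, mulmx1, mul0mx, mulmx0, addr0, add0r).
  rewrite mul_mx_scalar scalerA mulrN mulfV ?gt_eqF// scaleN1r addNr.
  rewrite mul0mx add0r mul_scalar_mx scalerA mulrN mulfV ?gt_eqF// scaleN1r addNr.
  by rewrite -scalemxAl addrC scaleNr.
(* The value of the Schur complement on [X] is that of [A] on the vector [row_mx 0 X *m L], which is
   nonzero since its last block is [X]. *)
have Spos X : X != 0 -> 0 < inner S X X.
  move=> X0.
  have -> : inner S X X = inner A (row_mx 0 X *m L) (row_mx 0 X *m L).
    rewrite inner_congruence LA /inner tr_row_mx trmx0 mul_row_block !mul0mx !add0r.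
    by rewrite mulmx0 mul_row_col mulmx0 add0r.
  apply: Apos; apply: contra X0 => /eqP.
  rewrite mul_row_block !mul0mx !add0r mulmx1 => E.
  by have := congr1 (@rsubmx R 1 1 n) E; rewrite row_mxKr linear0 => ->.
have SS : S^T = S.
  rewrite /S linearB /= linearZ /= trmx_mul trmxK; congr (_ - _).
  by rewrite trmx_drsub AS.
have [u' u'S] := IH S SS Spos.
pose D : 'M[R]_(1 + n) := block_mx (Num.sqrt a)^-1%:M 0 0 u'.
have DD : D *m block_mx a%:M 0 0 S *m D^T = 1%:M.
  rewrite /D tr_block_mx tr_scalar_mx !trmx0 !mulmx_block.
  rewrite !(mul0mx, mulmx0, addr0, add0r) u'S -!scalar_mxM.
  have -> : (Num.sqrt a)^-1 * a * (Num.sqrt a)^-1 = 1.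
    have s0 : Num.sqrt a != 0 by rewrite gt_eqF// sqrtr_gt0.
    rewrite -[X in _ * X * _]sqr_sqrtr ?ltW// expr2 mulrA mulVf// mul1r.
    exact: mulfV.
  by rewrite -scalar_mx_block.
by exists (D *m L); rewrite trmx_mul -DD -LA !mulmxA.
Qed.

(** * From natural metrics to the coordinate formulas *)

Section TangentBundleChart.
Context {R : realType} {n : nat} {M : atlas R n}.
Hypothesis mM : is_manifold M.
Variables (g : riemannian_metric M) (G : riemannian_metric (tangent_bundle M)).
Variables (alpha beta : R -> R).
Hypothesis G_natural : natural_metric g G.
Hypothesis G_char : characterized_by g G alpha beta.
Variable a : chart M.

Local Notation U := (chart_image a).
Local Notation TU := (lsubmx @^-1` U : set 'rV[R]_(n + n)).

Lemma open_chart_image : open U.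
Proof. by have := overlap_open mM (a := a) (b := a); rewrite /overlap setIid. Qed.

Lemma chart_image_tangent_bundle : @chart_image R (n + n) (tangent_bundle M) a = TU.
Proof.
apply/seteqP; split=> [z [V aV <-]|z [p ap px]].
  by rewrite /preimage /= row_mxKl; exists (tbase V).
have [V [Vp Vy]] := tvector_exists mM (rsubmx z) ap.
exists V; first by rewrite /= Vp.
by rewrite /= Vp Vy px hsubmxK.
Qed.

Lemma smooth_mx_gmx : smooth_mx U (g a).
Proof. by move=> i j; exact: gmx_smooth. Qed.

Lemma smooth_mx_tangent_bundle : smooth_mx TU (G a).
Proof. by move=> i j; rewrite -chart_image_tangent_bundle; exact: gmx_smooth. Qed.

Lemma tangent_bundle_sym z : TU z -> (G a z)^T = G a z.
Proof. by move=> Uz; apply: gmx_sym; rewrite chart_image_tangent_bundle. Qed.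

Lemma tangent_bundle_pos z : TU z -> forall W, W != 0 -> 0 < inner (G a z) W W.
Proof. by move=> Uz W; apply: gmx_pos; rewrite chart_image_tangent_bundle. Qed.

Lemma gmx_sym_on x : U x -> (g a x)^T = g a x.
Proof. exact: gmx_sym. Qed.

Lemma gmx_pos_on x : U x -> forall X, X != 0 -> 0 < inner (g a x) X X.
Proof. exact: gmx_pos. Qed.

Lemma tvector_of_coord z : TU z -> exists V : tvector M,
  [/\ chart_dom a (tbase V), chart_coord a (tbase V) = lsubmx z,
      tcomp V a = rsubmx z & Gmx G a V = G a z].
Proof.
rewrite -chart_image_tangent_bundle => -[V aV <-]; exists V; split=> //.
  by rewrite row_mxKl.
by rewrite row_mxKr.
Qed.

Lemma kappaE V W z : chart_coord a (tbase V) = lsubmx z -> tcomp V a = rsubmx z ->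
  kappa g a V W = connection_map (g a) W z.
Proof. by move=> Vx Vy; rewrite /kappa christoffel_formE Vx Vy. Qed.

(** [W] is the sum of a horizontal vector [h W] and a vertical vector [v W]. Orthogonality removes
    the cross terms, the submersion property evaluates the horizontal ones, and the vertical block
    gives the rest. *)
Lemma natural_metricE z : TU z -> forall W W', inner (G a z) W W' =
  inner (g a (lsubmx z)) (lsubmx W) (lsubmx W')
  + inner (vertical_metric (G a) z)
      (connection_map (g a) W z) (connection_map (g a) W' z).
Proof.
move=> Uz W W'; have [V [aV Vx Vy VG]] := tvector_of_coord Uz.
have [sub orth _] := G_natural.
pose v W := row_mx (0 : 'rV[R]_n) (connection_map (g a) W z).
pose h W := W - v W.
have lh W1 : lsubmx (h W1) = lsubmx W1 by rewrite /h linearB /= row_mxKl subr0.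
have rh W1 : rsubmx (h W1) = rsubmx W1 - connection_map (g a) W1 z.
  by rewrite /h linearB /= row_mxKr.
have hv W1 W2 : inner (G a z) (h W1) (row_mx 0 W2) = 0.
  rewrite -VG; apply: orth => //; last by rewrite /dproj row_mxKl.
  rewrite (kappaE _ Vx Vy) /connection_map lh rh /connection_map.
  by rewrite opprD addrA subrr add0r addNr.
have E W1 : W1 = h W1 + v W1 by rewrite subrK.
have hh : inner (G a z) (h W) (h W') =
    inner (g a (lsubmx z)) (lsubmx W) (lsubmx W').
  rewrite -VG sub//; last first.
    move=> Z Z0; rewrite VG -[Z]hsubmxK -/(dproj Z) Z0.
    by split; exact: hv.
  by rewrite Vx /dproj !lh.
rewrite [in LHS](E W) [in LHS](E W') innerDl.
rewrite (innerDr _ (h W) (h W') (v W')) (innerDr _ (v W) (h W') (v W')) hh hv.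
rewrite (inner_sym (v W) _ (tangent_bundle_sym Uz)) hv addr0 add0r.
by rewrite inner_vertical_metric.
Qed.

(** The characterization is stated in lifted orthonormal frames. Choosing one such frame [u] and
    changing basis by it gives the form in the chart. *)
Lemma vertical_metricE z X Y : TU z ->
  let gx := g a (lsubmx z) in let y := rsubmx z in
  let t := inner gx y y in
  inner (vertical_metric (G a) z) X Y =
  alpha t * inner gx X Y + beta t * inner gx y X * inner gx y Y.
Proof.
move=> Uz gx y t; have [V [aV Vx Vy VG]] := tvector_of_coord Uz.
have [u uu] := orthonormal_basis (gmx_sym_on Uz) (gmx_pos_on Uz).
have uunit : u \in unitmx by have [] := mulmx1_unit (etrans (mulmxA _ _ _) uu).
pose xi := y *m invmx u.
have yE : y = xi *m u by rewrite /xi -mulmxA mulVmx// mulmx1.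
have fr : frame_at g a V u xi by split; rewrite ?Vx ?Vy.
(* The lifted frame in coordinates: the correction [- H] makes the first [n] rows horizontal, and
   the last [n] rows are vertical copies of [u]. *)
pose H := \matrix_(i < n) (y *m gamma (g a) (row i u) (lsubmx z)).
pose e : 'M[R]_(n + n) := col_mx (row_mx u (- H)) (row_mx 0 u).
have rowl i : row (lshift n i) e = row_mx (row i u) (- row i H).
  by rewrite /e rowKu row_row_mx linearN.
have rowr i : row (rshift n i) e = row_mx 0 (row i u).
  by rewrite /e rowKd row_row_mx row0.
have lf : lifted_frame g a V u e.
  move=> i; rewrite rowl rowr !(kappaE _ Vx Vy) /connection_map /dproj.
  rewrite !row_mxKl !row_mxKr.
  by split=> //; rewrite ?rowK ?addNr// gamma0 mulmx0 addr0.
have [_ _ _ GE] := G_char; have := GE a V u xi e fr lf.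
set s := \sum_i _ => /= GE'.
have uG (c d : 'rV[R]_n) : inner gx (c *m u) (d *m u) = inner 1%:M c d.
  by rewrite inner_congruence uu.
have sE : s = t.
  rewrite /s /t yE uG /inner mulmx1 [RHS]mxE; apply: eq_bigr => i _.
  by rewrite [xi^T _ _]mxE expr2.
have QE : u *m vertical_metric (G a) z *m u^T =
    alpha t *: 1%:M + beta t *: (xi^T *m xi).
  apply/matrixP => i j; have [_ _] := GE' i j.
  rewrite sE mulmx_inner -inner_vertical_metric -!rowr -VG -mulmx_inner => ->.
  by rewrite !mxE big_ord1 !mxE mulrA.
have innerxi (c d : 'rV[R]_n) :
    inner (xi^T *m xi) c d = inner 1%:M xi c * inner 1%:M xi d.
  rewrite (inner_sym xi c (trmx1 _ _)) /inner !mulmx1.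
  have -> : c *m (xi^T *m xi) *m d^T = c *m xi^T *m (xi *m d^T) by rewrite !mulmxA.
  by rewrite [LHS]mxE big_ord1.
have XE (W : 'rV[R]_n) : W = W *m invmx u *m u by rewrite -mulmxA mulVmx// mulmx1.
rewrite {1}(XE X) {1}(XE Y) inner_congruence QE inner_mxD !inner_scale_mx innerxi.
by rewrite -!uG -!XE mulrA.
Qed.

Local Notation sGm := smooth_mx_tangent_bundle.

Lemma sectional_horizontal z X Y : TU z ->
  let gx := g a (lsubmx z) in let y := rsubmx z in
  let w := curvature (g a) (lsubmx z) X Y y in
  sectional (G a) z (horizontal (g a) z X) (horizontal (g a) z Y) =
  sectional (g a) (lsubmx z) X Y
  - 3 / 4 * (alpha (inner gx y y) * inner gx w w)
    / (inner gx X X * inner gx Y Y - inner gx X Y ^+ 2).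
Proof.
move=> Uz gx y w.
have oU := open_chart_image.
have oTU := open_lsubmx_preimage (m := n) oU.
have wE : w = y *m Omega (g a) X Y (lsubmx z).
  exact: (curvatureE oU smooth_mx_gmx gmx_pos_on).
(* Skewness makes this number equal to its opposite. It removes the [beta] term from the vertical
   square norm of [w]. *)
have w0 : inner gx y w = 0.
  have := curvature_skew oU smooth_mx_gmx gmx_sym_on gmx_pos_on X Y y y Uz.
  by rewrite (inner_sym _ _ (gmx_sym_on Uz)) -/gx -/w => ?; lra.
have num : inner (G a z) (curvature (G a) z (horizontal (g a) z X)
    (horizontal (g a) z Y) (horizontal (g a) z Y)) (horizontal (g a) z X) =
    inner gx (curvature (g a) (lsubmx z) X Y Y) X
    - 3 / 4 * (alpha (inner gx y y) * inner gx w w).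
  rewrite (curvatureE oTU sGm tangent_bundle_pos)//.
  rewrite (sectional_numerator_horizontal oU smooth_mx_gmx gmx_sym_on gmx_pos_on
    sGm tangent_bundle_sym tangent_bundle_pos natural_metricE Uz).
  rewrite -(curvatureE oU smooth_mx_gmx gmx_pos_on _ _ _ Uz) -wE vertical_metricE//.
  by rewrite w0 mulr0 addr0.
by rewrite /sectional num !(metric_horizontal natural_metricE Uz) mulrBl.
Qed.

(** Projecting the lifts back to the base is multiplication by [B], which cannot increase the
    rank. *)
Lemma row_free_horizontal z X Y : row_free (col_mx X Y) ->
  row_free (col_mx (horizontal (g a) z X) (horizontal (g a) z Y)).
Proof.
move=> XY; pose B := col_mx (1%:M : 'M[R]_n) (0 : 'M[R]_n).
have E : col_mx (horizontal (g a) z X) (horizontal (g a) z Y) *m B = col_mx X Y.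
  by rewrite mul_col_mx /horizontal !mul_row_col !mulmx1 !mulmx0 !addr0.
move: XY; rewrite /row_free -E => /eqP XY.
by rewrite eqn_leq rank_leq_row /= -[X in (X <= _)%N]XY mxrankM_maxl.
Qed.

Lemma sectional_curvatures_horizontal p X Y y : chart_dom a p ->
  row_free (col_mx X Y) ->
  let gx := g a (chart_coord a p) in
  let w := curvature (g a) (chart_coord a p) X Y y in
  sectional_curvatures G (sectional (g a) (chart_coord a p) X Y
    - 3 / 4 * (alpha (inner gx y y) * inner gx w w)
      / (inner gx X X * inner gx Y Y - inner gx X Y ^+ 2)).
Proof.
move=> ap XY gx w; have [V [Vp Vy]] := tvector_exists mM y ap.
pose z := row_mx (chart_coord a p) y.
have Uz : TU z by rewrite /preimage /= row_mxKl; exists p.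
exists a, V, (horizontal (g a) z X), (horizontal (g a) z Y); split.
- by rewrite /= Vp.
- exact: row_free_horizontal.
- rewrite (_ : @chart_coord _ _ (tangent_bundle M) a V = z); last by rewrite /= Vp Vy.
  rewrite sectional_horizontal//.
  by rewrite /z row_mxKl row_mxKr.
Qed.

Lemma vertical_metric_zero x : U x ->
  vertical_metric (G a) (row_mx x 0) = alpha 0 *: g a x.
Proof.
move=> Ux; have Uz : TU (row_mx x 0) by rewrite /preimage /= row_mxKl.
apply/matrixP => i j.
have A1 (A : 'M[R]_n) : A i j = inner A (row i 1%:M) (row j 1%:M).
  by rewrite -mulmx_inner trmx1 mulmx1 mul1mx.
rewrite A1 [RHS]A1 vertical_metricE// row_mxKl row_mxKr !inner0l inner_scale_mx.
by rewrite mulr0 addr0.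
Qed.

Lemma sectional_curvatures_mixed p (X : 'rV[R]_n) : chart_dom a p -> X != 0 ->
  sectional_curvatures G 0.
Proof.
move=> ap X0; have [V [Vp Vy]] := tvector_exists mM 0 ap.
have Ux : U (chart_coord a p) by exists p.
have oU := open_chart_image.
have oTU := open_lsubmx_preimage (m := n) oU.
pose z := row_mx (chart_coord a p) (0 : 'rV[R]_n).
have Uz : TU z by rewrite /preimage /= row_mxKl.
(* The plane spanned by the horizontal and the vertical lift of the same [X] at the zero vector. *)
exists a, V, (row_mx X 0), (row_mx 0 X); split; first by rewrite /= Vp.
  have Xx (v w : 'rV[R]_n) : row_mx v w != 0 = ~~ ((v == 0) && (w == 0)).
    by rewrite row_mx_eq0.
  apply: (row_free_orthogonal tangent_bundle_sym tangent_bundle_pos Uz).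
  - by rewrite Xx (negbTE X0).
  - by rewrite Xx (negbTE X0) andbF.
  - rewrite natural_metricE// /connection_map /z !row_mxKl !row_mxKr inner0r.
    by rewrite !mul0mx !addr0 inner0l addr0.
rewrite (_ : @chart_coord _ _ (tangent_bundle M) a V = z); last by rewrite /= Vp Vy.
rewrite /sectional (curvatureE oTU sGm tangent_bundle_pos)//.
by rewrite (sectional_numerator_mixed oU smooth_mx_gmx gmx_sym_on gmx_pos_on
  sGm tangent_bundle_sym tangent_bundle_pos natural_metricE vertical_metric_zero)// mul0r.
Qed.

End TangentBundleChart.

(** * Flatness and the four assertions *)

Lemma flat_of_sectional0 (R : realType) (n : nat) (M : atlas R n)
    (g : riemannian_metric M) :
  (forall a : chart M, open (chart_image a)) ->
  (forall k, sectional_curvatures g k -> k = 0) -> flat g.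
Proof.
move=> oU K0 a p ap; have Ux : chart_image a (chart_coord a p) by exists p.
have sg : smooth_mx (chart_image a) (g a) by move=> i j; exact: gmx_smooth.
have gS x : chart_image a x -> (g a x)^T = g a x by exact: gmx_sym.
have gpos x : chart_image a x -> forall X, X != 0 -> 0 < inner (g a x) X X.
  exact: gmx_pos.
apply: (curvature_eq0_sectional (oU a) sg gS gpos Ux) => X Y X0 Y0 XY.
have rf := row_free_orthogonal gS gpos Ux X0 Y0 XY.
have /eqP : sectional (g a) (chart_coord a p) X Y = 0.
  by apply: K0; exists a, p, X, Y.
rewrite /sectional XY expr0n /= subr0 mulf_eq0 invr_eq0.
by rewrite (gt_eqF (mulr_gt0 (gpos _ Ux _ X0) (gpos _ Ux _ Y0))) orbF => /eqP.
Qed.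

Theorem corollary4p7 (R : realType) (n : nat) (n_ge2 : (2 <= n)%N)
    (M : atlas R n) (M_manifold : is_manifold M)
    (g : riemannian_metric M) (G : riemannian_metric (tangent_bundle M))
    (alpha beta : R -> R) (G_natural : natural_metric g G)
    (G_char : characterized_by g G alpha beta) :
  [/\ ~ (forall k, sectional_curvatures G k -> k < 0),
      (exists c : R, forall k, sectional_curvatures G k -> k = c) ->
        flat G /\ flat g,
      (exists B : R, forall k, sectional_curvatures G k -> `|k| <= B) ->
        (t * alpha t @[t --> +oo] --> +oo) -> flat g &
      forall c C : \bar R,
        (forall k, sectional_curvatures G k -> (c <= k%:E <= C)%E) ->
        forall k, sectional_curvatures g k -> (c <= k%:E <= C)%E].
Proof.
have oU := open_chart_image M_manifold.
have G0 : sectional_curvatures G 0.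
  have [p _] := manifold_nonempty M_manifold.
  have [a ap] := charts_cover M_manifold p.
  have X0 : const_mx 1 != 0 :> 'rV[R]_n.
    apply/eqP => /rowP/(_ (Ordinal (ltnW n_ge2)))/eqP.
    by rewrite !mxE oner_eq0.
  exact: (sectional_curvatures_mixed M_manifold G_natural G_char ap X0).
(* At the zero vector the correction to the horizontal curvature vanishes, so every sectional
   curvature of [M] occurs on [TM]. *)
have gG k : sectional_curvatures g k -> sectional_curvatures G k.
  move=> [a [p [X [Y [ap XY ->]]]]].
  have := sectional_curvatures_horizontal M_manifold G_natural G_char 0 ap XY.
  rewrite /= (_ : curvature (g a) _ X Y 0 = 0) ?inner0l ?mulr0 ?mul0r ?subr0//.
  by rewrite -[0 in LHS](scale0r 0) curvatureZr scale0r.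
split.
- by move=> /(_ 0 G0); rewrite ltxx.
- move=> [c cK]; have c0 : c = 0 by rewrite (cK 0 G0).
  have K0 k : sectional_curvatures G k -> k = 0 by move/cK; rewrite c0.
  split; apply: flat_of_sectional0 => //; last by move=> k /gG/K0.
  move=> a; rewrite (chart_image_tangent_bundle M_manifold).
  exact: open_lsubmx_preimage.
- move=> [B KB] ta a p ap X Y v.
  have Ux : chart_image a (chart_coord a p) by exists p.
  have gS := @gmx_sym_on _ _ _ g a; have gpos := @gmx_pos_on _ _ _ g a.
  (* With [v] fixed, it suffices to treat orthogonal [X] and [Y]; suppose then that [w], the
     curvature applied to [v], is nonzero. *)
  move: X Y; apply: (curvature_eq0_orthogonal (oU a) (smooth_mx_gmx g a) gpos Ux).
  move=> X Y X0 Y0 XY; apply/eqP; apply: contraT => w0.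
  set gx := g a (chart_coord a p) in XY *.
  set w := curvature _ _ _ _ _ in w0.
  have v0 : v != 0.
    apply: contraNneq w0 => v0; rewrite /w v0.
    by rewrite -[0 in X in X == _](scale0r 0) curvatureZr scale0r.
  have rf := row_free_orthogonal gS gpos Ux X0 Y0 XY.
  have T0 : 0 < inner gx v v by exact: gpos.
  have W0 : 0 < inner gx w w by exact: gpos.
  have d0 : 0 < inner gx X X * inner gx Y Y by rewrite mulr_gt0 ?gpos.
  set T := inner gx v v in T0; set W := inner gx w w in W0.
  set d := inner gx X X * inner gx Y Y in d0.
  set k := sectional (g a) (chart_coord a p) X Y.
  (* At a multiple of [v] with square norm [t], the square norm of [w] becomes [t / T * W], so the
     horizontal curvature is [k - D * (t * alpha t)], which is unbounded below. *)
  pose D := 3 / 4 * W / (T * d).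
  have q0 : 0 < 3 / 4 :> R by lra.
  have D0 : 0 < D by apply: divr_gt0; exact: mulr_gt0.
  have [N [_ HN]] : \forall t \near +oo, (`|k| + B + 1) / D <= t * alpha t.
    by move/cvgryPge : ta; exact.
  (* The neighbourhood of [+oo] is an open half-line, so [t] must exceed [N] strictly; it is also
     made positive. *)
  pose t := Num.max N 0 + 1.
  have t0 : 0 < t by rewrite ltr_wpDl// le_max lexx orbT.
  have Nt : (`|k| + B + 1) / D <= t * alpha t.
    by apply: HN; rewrite ltr_pwDr// le_max lexx.
  (* The factor for which [s *: v] has square norm [t]. *)
  pose s := Num.sqrt (t / T).
  have s2 : s * s = t / T by rewrite -expr2 sqr_sqrtr// divr_ge0 ?ltW.
  have := KB _
    (sectional_curvatures_horizontal M_manifold G_natural G_char (s *: v) ap rf).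
  rewrite /= curvatureZr -/gx -/w !innerZl !innerZr -/T -/W XY expr0n subr0 -/k -/d.
  rewrite !mulrA s2 divfK ?gt_eqF//.
  have -> : 3 / 4 * alpha t * s * s * W / d = D * (t * alpha t).
    rewrite -[3 / 4 * _ * s * s]mulrA s2 /D; field.
    by rewrite !gt_eqF.
  rewrite ler_norml => /andP[+ _].
  move: Nt; rewrite ler_pdivrMr// [_ * D]mulrC => Nt.
  have := ler_norm k => kk kB; lra.
- by move=> c C H k /gG/H.
Qed.
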